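(* Let $m\ge 2$, let $M_1,\dots,M_m$ be smooth manifolds of dimensions $n_1,\dots,n_m$, let $\mu_i$ be a Borel probability measure on $M_i$ for each $i$, and let $c\in C^2(M_1\times\cdots\times M_m)$. Let $N=\sum_{i=1}^m n_i$. Let $g=\sum_{p\in P}t_p g_p$ be a convex combination of the semi-Riemannian metrics $g_p$, i.e. $0\le t_p\le 1$ for all $p\in P$ and $\sum_{p\in P}t_p=1$. Suppose $\gamma$ is an optimizer with $C(\gamma)<\infty$, and let $x=(x_1,\dots,x_m)\in M_1\times\cdots\times M_m$. Suppose the $(+,-,0)$ signature of $g$ at $x$ is $(q_+,q_-,N-q_+-q_-)$. Then there is a neighbourhood $O$ of $x$ such that $\operatorname{spt}(\gamma)\cap O$ is contained in a Lipschitz submanifold of dimension $N-q_+$. Moreover, wherever $\operatorname{spt}(\gamma)$ is smooth, it is non-spacelike for $g$; that is, at every point $y\in\operatorname{spt}(\gamma)$ near which $\operatorname{spt}(\gamma)$ is a smooth submanifold, every vector $v$ tangent to $\operatorname{spt}(\gamma)$ at $y$ satisfies $g_y(v,v)\le 0$.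
   Context: For a Borel measure $\gamma$ on $M_1\times\cdots\times M_m$ put $C(\gamma)=\int c(x_1,\dots,x_m)\,d\gamma$. An optimizer is a measure $\gamma$ minimizing $C$ among all Borel measures on $M_1\times\cdots\times M_m$ whose projection onto $M_i$ is $\mu_i$ for every $i=1,\dots,m$; the condition $C(\gamma)<\infty$ is understood as: $C(\gamma)$ is a well-defined finite number. The support $\operatorname{spt}(\gamma)$ is the smallest closed set of full $\gamma$-mass. $P$ is the set of all partitions $p$ of $\{1,\dots,m\}$ into two disjoint nonempty subsets, labelled $p_+$ and $p_-$ (so $P$ has $2^{m-1}-1$ elements). For $p\in P$, $g_p$ is the symmetric bilinear form on $M_1\times\cdots\times M_m$ given in local coordinates by $$g_p=\sum_{j\in p_+,\,k\in p_-}\ \sum_{\alpha_j,\alpha_k}\frac{\partial^2 c}{\partial x_j^{\alpha_j}\partial x_k^{\alpha_k}}\left(dx_j^{\alpha_j}\otimes dx_k^{\alpha_k}+dx_k^{\alpha_k}\otimes dx_j^{\alpha_j}\right).$$ A semi-Riemannian metric here means a symmetric covariant 2-tensor, possibly degenerate. Its signature $(q_+,q_-,N-q_+-q_-)$ at a point records the numbers of positive, negative and zero eigenvalues (with multiplicity) of its matrix in local coordinates. A $d$-dimensional Lipschitz submanifold is a set which locally, in suitable smooth local coordinates, is the graph of a Lipschitz function of $d$ of the coordinates. *)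

(* Defs.v *)
From HB Require Import structures.
From mathcomp Require Import all_boot all_order all_algebra.
From mathcomp Require Import all_classical all_reals all_analysis.

Set Implicit Arguments.
Unset Strict Implicit.
Unset Printing Implicit Defensive.

Import Order.TTheory GRing.Theory Num.Theory.
Import numFieldNormedType.Exports.

Local Open Scope classical_set_scope.
Local Open Scope ring_scope.

Section Smoothness.
Context {R : realType} {E F : normedModType R}.

(* [C^k] on an open subset [U] of a finite-dimensional space [E]; the values
   of [f] outside [U] are irrelevant. *)
Fixpoint Ck (k : nat) (U : set E) (f : E -> F) : Prop :=
  match k with
  | 0 => {in U, continuous f}
  | k'.+1 => {in U, forall u, differentiable f u} /\
             forall v : E, Ck k' U ('D_v f)
  end.

Definition Cinfty (U : set E) (f : E -> F) : Prop := forall k, Ck k U f.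

End Smoothness.

(* Raw data of a local chart: the coordinates [cmap] are meaningful on [cdom]
   only, their inverse [cinv] on [cmap @` cdom] only. *)
Record chart (R : realType) (T : Type) (n : nat) := Chart {
  cdom : set T;
  cmap : T -> 'rV[R]_n;
  cinv : 'rV[R]_n -> T }.

Section Charts.
Context {R : realType} {T : topologicalType} {n : nat}.
Implicit Types phi psi : chart R T n.

Definition cimg phi : set 'rV[R]_n := cmap phi @` cdom phi.

Definition is_chart phi : Prop :=
  [/\ open (cdom phi), open (cimg phi),
      {in cdom phi, cancel (cmap phi) (cinv phi)},
      {in cdom phi, continuous (cmap phi)} &
      {in cimg phi, continuous (cinv phi)}].

Definition smooth_transition phi psi : Prop :=
  Cinfty (cmap phi @` (cdom phi `&` cdom psi)) (cmap psi \o cinv phi).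

Definition compatible phi psi : Prop :=
  smooth_transition phi psi /\ smooth_transition psi phi.

(* Smooth local coordinates for the smooth structure generated by [A], i.e. a
   chart of the maximal atlas. *)
Definition smooth_chart (A : set (chart R T n)) psi : Prop :=
  is_chart psi /\ forall phi, A phi -> compatible phi psi.

Definition Ck_manifold (A : set (chart R T n)) (k : nat) (f : T -> R) : Prop :=
  forall phi, A phi -> Ck k (cimg phi) (f \o cinv phi).

(* [a] selects [d] of the [n] coordinates and [b] the remaining [n - d]. *)
Definition lipschitz_submanifold (A : set (chart R T n)) (d : nat)
    (S : set T) : Prop :=
  forall y, S y ->
  exists (psi : chart R T n) (a : 'I_d -> 'I_n) (b : 'I_(n - d) -> 'I_n)
         (W : set 'rV[R]_d) (f : 'rV[R]_d -> 'rV[R]_(n - d)),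
    [/\ smooth_chart A psi /\ cdom psi y,
        [/\ injective a, injective b & forall i j, a i <> b j],
        open W, [lipschitz f u | u in W] &
        cmap psi @` (S `&` cdom psi) =
          [set w | W (colsub a w) /\ colsub b w = f (colsub a w)]].

(* Near [y], [S] is an embedded [d]-dimensional smooth submanifold (local slice
   condition). *)
Definition smooth_submanifold_near (A : set (chart R T n)) (d : nat)
    (S : set T) (y : T) : Prop :=
  (d <= n)%N /\
  exists psi : chart R T n,
    [/\ smooth_chart A psi, cdom psi y &
        S `&` cdom psi =
          [set z | cdom psi z /\
                   forall k : 'I_n, (d <= k)%N -> cmap psi z 0 k = 0]].

(* [v] is the expression, in the coordinates [phi], of the velocity at [y] of
   a smooth curve in [S] through [y]. *)
Definition tangent_in (S : set T) (phi : chart R T n) (y : T)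
    (v : 'rV[R]_n) : Prop :=
  exists (e : R) (tau : R -> T),
    [/\ 0 < e, tau 0 = y,
        forall s, ball (0 : R) e s -> S (tau s) /\ cdom phi (tau s),
        Cinfty (ball (0 : R) e) (cmap phi \o tau) &
        'D_1 (cmap phi \o tau) 0 = v].

End Charts.

Record smooth_structure (R : realType) (T : topologicalType) (n : nat) :=
  SmoothStructure {
    atlas : set (chart R T n);
    atlas_chart : forall phi, atlas phi -> is_chart phi;
    atlas_cover : forall x, exists2 phi, atlas phi & cdom phi x;
    atlas_compatible :
      forall phi psi, atlas phi -> atlas psi -> compatible phi psi;
    manifold_hausdorff : hausdorff_space T;
    manifold_second_countable : @second_countable T }.

HB.instance Definition _ (I : Type) (T : I -> ptopologicalType) :=
  isPointed.Build (prod_topology T) (fun=> point).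

Section ProductManifold.
Context {R : realType} {m : nat} {n : 'I_m -> nat}.
Context {M : 'I_m -> ptopologicalType}.

Definition prod_chart (phi : forall i, chart R (M i) (n i)) :
    chart R (prod_topology M) (\sum_i n i)%N :=
  Chart [set x | forall i, cdom (phi i) (x i)]
        (fun x => \mxrow_i cmap (phi i) (x i))
        (fun u i => cinv (phi i) (submxrow u i)).

Definition in_atlases (A : forall i, smooth_structure R (M i) (n i))
    (phi : forall i, chart R (M i) (n i)) : Prop :=
  forall i, atlas (A i) (phi i).

Definition prod_atlas (A : forall i, smooth_structure R (M i) (n i)) :
    set (chart R (prod_topology M) (\sum_i n i)%N) :=
  [set prod_chart phi | phi in in_atlases A].

End ProductManifold.

Section Metrics.
Context {R : realType} {m : nat} {n : 'I_m -> nat}.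
Context {M : 'I_m -> ptopologicalType}.
Local Notation N := (\sum_i n i)%N.

Definition coord_vec (j : 'I_m) (a : 'I_(n j)) : 'rV[R]_N :=
  delta_mx 0 (tagnat.Rank j a).

Definition mixed_partial (c : prod_topology M -> R)
    (phi : forall i, chart R (M i) (n i)) (x : prod_topology M)
    (j : 'I_m) (a : 'I_(n j)) (k : 'I_m) (b : 'I_(n k)) : R :=
  'D_(coord_vec a) ('D_(coord_vec b) (c \o cinv (prod_chart phi)))
    (cmap (prod_chart phi) x).

(* Matrix of [g_p] at [x] in the coordinates [prod_chart phi], where
   [p = {pplus, pminus}]. *)
Definition gp_mx (c : prod_topology M -> R)
    (phi : forall i, chart R (M i) (n i)) (x : prod_topology M)
    (pplus pminus : {set 'I_m}) : 'M[R]_N :=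
  \sum_(j in pplus) \sum_(k in pminus) \sum_(a < n j) \sum_(b < n k)
    mixed_partial c phi x a b *:
      (delta_mx (tagnat.Rank j a) (tagnat.Rank k b) +
       delta_mx (tagnat.Rank k b) (tagnat.Rank j a)).

End Metrics.

Definition bipartitions (m : nat) : {set {set {set 'I_m}}} :=
  [set p | finset.partition p [set: 'I_m] & #|p| == 2%N].

Definition labelling (m : nat) (lp lm : {set {set 'I_m}} -> {set 'I_m}) : Prop :=
  forall p, p \in bipartitions m -> p = [set lp p; lm p]%SET.

Definition g_mx {R : realType} {m : nat} {n : 'I_m -> nat}
    {M : 'I_m -> ptopologicalType} (c : prod_topology M -> R)
    (lp lm : {set {set 'I_m}} -> {set 'I_m}) (t : {set {set 'I_m}} -> R)
    (phi : forall i, chart R (M i) (n i)) (x : prod_topology M) :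
    'M[R]_(\sum_i n i) :=
  \sum_(p in bipartitions m) t p *: gp_mx c phi x (lp p) (lm p).

(* The list [s] consists of the eigenvalues with algebraic multiplicity. *)
Definition signature {R : realType} {N : nat} (G : 'M[R]_N) (qp qm : nat) :
    Prop :=
  exists s : seq R,
    [/\ char_poly G = \prod_(l <- s) ('X - l%:P),
        count (fun l => 0 < l) s = qp & count (fun l => l < 0) s = qm].

(* By Sylvester's law of inertia the choice of the coordinates is irrelevant. *)
Definition signature_at {R : realType} {m : nat} {n : 'I_m -> nat}
    {M : 'I_m -> ptopologicalType}
    (A : forall i, smooth_structure R (M i) (n i)) (c : prod_topology M -> R)
    (lp lm : {set {set 'I_m}} -> {set 'I_m}) (t : {set {set 'I_m}} -> R)
    (x : prod_topology M) (qp qm : nat) : Prop :=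
  exists phi : forall i, chart R (M i) (n i),
    [/\ in_atlases A phi, cdom (prod_chart phi) x &
        signature (g_mx c lp lm t phi x) qp qm].

Notation borel T := (g_sigma_algebraType (@open T)).

Section Optimizers.
Context {R : realType} {m : nat} {M : 'I_m -> ptopologicalType}.
Local Notation X := (prod_topology M).
Local Open Scope ereal_scope.

Definition has_marginals
    (mu : forall i, probability (borel (M i)) R)
    (gamma : {measure set (borel X) -> \bar R}) : Prop :=
  forall i (B : set (borel (M i))), measurable B ->
    pushforward gamma (fun x : borel X => x i : borel (M i)) B = mu i B.

Definition cost (c : X -> R) (gamma : {measure set (borel X) -> \bar R}) :
    \bar R :=
  \int[gamma]_x (c x)%:E.

Definition cost_defined (c : X -> R)
    (gamma : {measure set (borel X) -> \bar R}) : Prop :=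
  (\int[gamma]_x ((EFin \o c)^\+ x) < +oo) \/
  (\int[gamma]_x ((EFin \o c)^\- x) < +oo).

Definition cost_finite (c : X -> R)
    (gamma : {measure set (borel X) -> \bar R}) : Prop :=
  gamma.-integrable setT (EFin \o c : borel X -> \bar R).

(* Competitors whose cost is of the form [oo - oo] are ignored. *)
Definition optimizer (c : X -> R)
    (mu : forall i, probability (borel (M i)) R)
    (gamma : {measure set (borel X) -> \bar R}) : Prop :=
  has_marginals mu gamma /\
  forall gamma' : {measure set (borel X) -> \bar R},
    has_marginals mu gamma' -> cost_defined c gamma' ->
    cost c gamma <= cost c gamma'.

End Optimizers.

Definition spt {R : realType} {T : ptopologicalType}
    (gamma : {measure set (borel T) -> \bar R}) : set T :=
  \bigcap_(F in [set F : set T | closed F /\ gamma (~` F) = 0%E]) F.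

(* Main.v *)
Require Import Defs.
From mathcomp Require Import all_boot all_order all_algebra.
From mathcomp Require Import all_classical all_reals all_analysis.
From mathcomp Require Import measurable_realfun ring lra.
Import Order.TTheory GRing.Theory Num.Theory.
Import numFieldNormedType.Exports.
Local Open Scope classical_set_scope.
Local Open Scope ring_scope.

Set Implicit Arguments.
Unset Strict Implicit.
Unset Printing Implicit Defensive.

(** Swapping the coordinates indexed by [p] between two points [x], [y] of the
    support cannot lower the total cost: otherwise let [(u, v)] follow
    [gamma x gamma], swap these coordinates when [u] is close to [x] and [v] is
    close to [y], and average the laws of the two resulting points; this
    competitor has the same marginals as [gamma] and a smaller cost.  In a
    product chart the swap inequality says that a second order double
    difference of [c] is nonpositive; the mean value theorem turns it into
    [g_p(w, w) <= e |w|^2] for the increments [w] between points of the support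
    close to a given point, hence the same holds for [g].  Dividing by the
    squared time along a curve shows that tangent vectors are non-spacelike.
    In coordinates that diagonalize [g] orthogonally, the inequality bounds the
    [q_+] positive components of [w] by a multiple of the other [N - q_+], so
    that the support is locally part of a graph over the latter, which McShane's
    formula extends to a full Lipschitz graph. *)

(** * Product topology *)

Section ProductTopology.
Context {I : Type} {T : I -> topologicalType}.

Lemma prod_cvg (F : set_system (prod_topology T)) (x : prod_topology T) :
  Filter F -> (forall i, (fun z : prod_topology T => z i) @ F --> x i) ->
  F --> x.
Proof.
move=> FF h; apply/cvg_sup => i A.
rewrite (@nbhsE (initial_topology (fun f : (forall i, T i) => f i))).
move=> [_ [[B oB <-] Bx] BA]; apply: (filterS BA).
by apply: (h i); apply: open_nbhs_nbhs.
Qed.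

Lemma prod_proj_continuous i : continuous (fun z : prod_topology T => z i).
Proof.
move=> x A; rewrite nbhsE => -[B [oB Bx] BA].
have /cvg_sup/(_ i) : nbhs x --> x by exact: cvg_id.
apply; rewrite (@nbhsE (initial_topology (fun f : (forall i, T i) => f i))).
exists ((fun f : forall i, T i => f i) @^-1` B); first by split=> //; exists B.
by move=> z /BA.
Qed.

End ProductTopology.

(** Boxes around [x] generate a filter that converges to [x] in each coordinate, so by [prod_cvg] it
    refines the neighbourhood filter. The converse uses that [I] is finite: a box is then a finite
    intersection of preimages of neighbourhoods. *)
Lemma prod_nbhs_box {I : finType} {T : I -> topologicalType}
    (x : prod_topology T) (O : set (prod_topology T)) :
  nbhs x O <->
  exists U : forall i, set (T i), (forall i, nbhs (x i) (U i)) /\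
    [set z : prod_topology T | forall i, U i (z i)] `<=` O.
Proof.
split=> [xO|[U [xU UO]]]; last first.
  apply: (filterS UO).
  apply: (@filter_forall _ _ (fun i (z : prod_topology T) => U i (z i)) (nbhs x)) => i.
  exact: (@prod_proj_continuous _ T i x (U i) (xU i)).
pose B := [set U : forall i, set (T i) | forall i, nbhs (x i) (U i)].
pose F := filter_from B
  (fun U => [set z : prod_topology T | forall i, U i (z i)]).
have FF : Filter F.
  apply: filter_from_filter.
    by exists (fun=> setT) => i; apply: filterT.
  move=> U V BU BV; exists (fun i => U i `&` V i) => [i|z UVz].
    exact: filterI.
  by split => i; have [] := UVz i.
have [U BU UO] : F O.
  apply: (@prod_cvg _ T F x) => // i A xA.
  exists (dfwith (fun j => @setT (T j)) i A).
    by move=> j /=; case: dfwithP => // *; apply: filterT.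
  by move=> z /(_ i); rewrite dfwithin.
by exists U; split.
Qed.

(** A countable base consisting of open boxes, rather than of arbitrary open sets, is what
    [measurable_mix] needs. It is indexed by finite functions that choose one basic open set per
    factor. *)
Lemma prod_second_countable {I : finType} {T : I -> topologicalType} :
  (forall i, @second_countable (T i)) ->
  exists B : nat -> set (prod_topology T),
    (forall k, exists U : forall i, set (T i), (forall i, open (U i)) /\
       B k = [set z : prod_topology T | forall i, U i (z i)]) /\
    forall O : set (prod_topology T), open O ->
      O = \bigcup_(k in [set k | B k `<=` O]) B k.
Proof.
move=> cT.
have bex i : exists b : nat -> set (T i), (forall k, open (b k)) /\
    forall x V, nbhs x V -> exists2 k, b k x & b k `<=` V.
  have [B /countable_injP[e einj] [oB xB]] := cT i.
  exists (fun k => \bigcup_(V in [set V | B V /\ e V = k]) V); split.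
    by move=> k; apply: bigcup_open => V [BV _]; exact: oB.
  move=> x V /xB[W [BW Wx] WV]; exists (e W); first by exists W.
  move=> y [W' [BW' eW'] W'y]; apply: WV.
  by rewrite (einj W W') ?inE.
pose b i := projT1 (cid (bex i)); have bP i := projT2 (cid (bex i)).
pose B (f : {ffun I -> nat}) :=
  [set z : prod_topology T | forall i, b i (f i) (z i)].
(* Codes [k] of no function receive the whole space, which is itself an open box. *)
exists (fun k => if unpickle k is Some f then B f else setT).
split.
  move=> k; case: unpickle => [f|].
    by exists (fun i => b i (f i)); split => // i; exact: (bP i).1.
  exists (fun=> setT); split => [i|]; first exact: openT.
  by rewrite eqEsubset; split.
move=> O oO; rewrite eqEsubset; split => [z Oz|z [k /= kO]]; last exact: kO.
have /prod_nbhs_box[U [zU UO]] : nbhs z O by exact: open_nbhs_nbhs.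
have fex i : exists k, b i k (z i) /\ b i k `<=` U i.
  by have [k] := (bP i).2 _ _ (zU i); exists k.
pose f i := projT1 (cid (fex i)); have fP i := projT2 (cid (fex i)).
have Bz : B (finfun f) z by move=> i; rewrite ffunE; exact: (fP i).1.
exists (pickle (finfun f)); rewrite /= pickleK// => y By.
by apply: UO => i; apply: (fP i).2; move: (By i); rewrite ffunE.
Qed.

(** * Swapping coordinates of an optimal measure *)

Section HalfSumPushforward.
Local Open Scope ereal_scope.
Context d d' (Y : measurableType d) (T : measurableType d') (R : realType).
Context (Q : {measure set Y -> \bar R}) (F1 F2 : Y -> T).
Context (mF1 : measurable_fun [set: Y] F1) (mF2 : measurable_fun [set: Y] F2).

(** [nu] is the mean of the two image measures. The change of variables is proved first for
    nonnegative functions; integrability makes all positive and negative parts finite, so that they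
    can be recombined by real arithmetic. *)
Lemma half_sum_pushforward :
  exists nu : {measure set T -> \bar R},
    (forall A, nu A = (2^-1)%:E * (Q (F1 @^-1` A) + Q (F2 @^-1` A))) /\
    forall f : T -> \bar R, measurable_fun [set: T] f ->
      Q.-integrable setT (f \o F1) -> Q.-integrable setT (f \o F2) ->
      nu.-integrable setT f /\
      \int[nu]_x f x =
        (2^-1)%:E * (\int[Q]_y (f \o F1) y + \int[Q]_y (f \o F2) y).
Proof.
have k0 : (0 <= 2^-1 :> R)%R by rewrite invr_ge0.
pose nu1 : {measure set T -> \bar R} :=
  measure_function_pushforward__canonical__measure_function_Measure Q mF1.
pose nu2 : {measure set T -> \bar R} :=
  measure_function_pushforward__canonical__measure_function_Measure Q mF2.
pose nu12 := measure_add nu1 nu2.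
pose nu := mscale (NngNum k0) nu12.
have nu_ge0 (f : T -> \bar R) : measurable_fun [set: T] f ->
    (forall x, 0 <= f x) ->
    \int[nu]_x f x =
        (2^-1)%:E * (\int[Q]_y (f \o F1) y + \int[Q]_y (f \o F2) y).
  move=> mf f0; rewrite ge0_integral_mscale//.
  rewrite ge0_integral_measure_add//.
  congr (_ * (_ + _)).
    by rewrite (ge0_integral_pushforward mF1 Q).
    by rewrite (ge0_integral_pushforward mF2 Q).
exists nu; split=> [A|f mf f1 f2].
  by rewrite -[Q (F1 @^-1` A)]/(nu1 A) -[Q (F2 @^-1` A)]/(nu2 A) -measure_addE.
have intf : nu.-integrable setT f.
  apply/integrableP; split => //.
  rewrite nu_ge0//; last exact: measurableT_comp.
  rewrite lte_mul_pinfty// ?lee_fin//.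
  move/integrableP : f1 => [_ f1]; move/integrableP : f2 => [_ f2].
  exact: lte_add_pinfty.
split => //.
have fp := measurable_funepos mf; have fn := measurable_funeneg mf.
have p1 := integrable_pos_fin_num measurableT f1;
  have n1 := integrable_neg_fin_num measurableT f1.
have p2 := integrable_pos_fin_num measurableT f2;
  have n2 := integrable_neg_fin_num measurableT f2.
rewrite integralE (nu_ge0 _ fp)// (nu_ge0 _ fn)//.
rewrite (integralE Q setT (f \o F1)) (integralE Q setT (f \o F2)).
rewrite -!funepos_comp -!funeneg_comp.
rewrite -(fineK p1) -(fineK p2) -(fineK n1) -(fineK n2).
by rewrite -!(EFinD, EFinN, EFinM); congr EFin; ring.
Qed.
End HalfSumPushforward.

Section ProductProbability.
Local Open Scope ereal_scope.
Context d (T : measurableType d) (R : realType) (P : probability T R).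

Lemma integral_comp_fst (f : T -> \bar R) : P.-integrable setT f ->
  (P \x P).-integrable setT (f \o fst) /\
  \int[P \x P]_z (f \o fst) z = \int[P]_x f x.
Proof.
move=> fi; have mf := measurable_int _ fi.
have mff : measurable_fun [set: T * T] (f \o fst) by exact: measurableT_comp.
have ffi : (P \x P).-integrable setT (f \o fst).
  apply/integrableP; split => //.
  rewrite fubini_tonelli1//=; last exact: measurableT_comp.
  rewrite /fubini_F/=.
  under eq_integral do rewrite integral_cst//
    [X in _ * X](@probability_setT _ _ _ P) mule1.
  by case/integrableP : fi.
split => //; rewrite -integral12_prod_meas1//.
by apply: eq_integral => x _;
  rewrite /fubini_F /fubini_G/= integral_cst//
    [X in _ * X](@probability_setT _ _ _ P) mule1.
Qed.

Lemma integral_comp_snd (f : T -> \bar R) : P.-integrable setT f ->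
  (P \x P).-integrable setT (f \o snd) /\
  \int[P \x P]_z (f \o snd) z = \int[P]_x f x.
Proof.
move=> fi; have mf := measurable_int _ fi.
have mff : measurable_fun [set: T * T] (f \o snd) by exact: measurableT_comp.
have ffi : (P \x P).-integrable setT (f \o snd).
  apply/integrableP; split => //.
  rewrite fubini_tonelli2//=; last exact: measurableT_comp.
  rewrite /fubini_G/=.
  under eq_integral do rewrite integral_cst//
    [X in _ * X](@probability_setT _ _ _ P) mule1.
  by case/integrableP : fi.
split => //; rewrite -integral21_prod_meas1//.
by apply: eq_integral => x _;
  rewrite /fubini_F /fubini_G/= integral_cst//
    [X in _ * X](@probability_setT _ _ _ P) mule1.
Qed.

End ProductProbability.

(** The competitor is the mean of the laws of [F1] and [F2] under [P \x P]. The bounds by [K] make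
    its cost integrable, and integrating the pointwise inequality gives a gain of at least half of
    [delta] times the mass of [E]. *)
Lemma swap_cost_lt d (T : measurableType d) (R : realType)
    (P : probability T R) (c : T -> R) (F1 F2 : T * T -> T)
    (E : set (T * T)) (K delta : R) :
  measurable_fun [set: T * T] F1 -> measurable_fun [set: T * T] F2 ->
  measurable E -> P.-integrable setT (EFin \o c) ->
  (forall z, `|c (F1 z)| <= `|c z.1| + K) ->
  (forall z, `|c (F2 z)| <= `|c z.2| + K) ->
  0 < delta ->
  (forall z, c (F1 z) + c (F2 z) <= c z.1 + c z.2 - delta * \1_E z) ->
  (0 < (P \x P)%E E)%E ->
  exists nu : {measure set T -> \bar R},
    [/\ (forall A, nu A = (2^-1)%:E *
          ((P \x P) (F1 @^-1` A) + (P \x P) (F2 @^-1` A)))%E,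
        nu.-integrable setT (EFin \o c) &
        (\int[nu]_x (c x)%:E < \int[P]_x (c x)%:E)%E].
Proof.
move=> mF1 mF2 mE ci c1 c2 d0 c12 E0.
have mc : measurable_fun [set: T] (EFin \o c) := measurable_int _ ci.
pose Q : {measure set (T * T) -> \bar R} := (P \x P)%E.
have [nu [nuE nui]] := half_sum_pushforward Q mF1 mF2.
have [ci1 Ic1] := integral_comp_fst ci; have [ci2 Ic2] := integral_comp_snd ci.
have cKi : P.-integrable setT (fun x => (`|c x| + K)%:E).
  exact: (integrableD measurableT (integrable_abse ci)
    (finite_measure_integrable_cst P K measurableT)).
have [cKi1 _] := integral_comp_fst cKi; have [cKi2 _] := integral_comp_snd cKi.
have Fi1 : Q.-integrable setT ((EFin \o c) \o F1).
  apply: (le_integrable measurableT _ _ cKi1) => //; first exact: measurableT_comp.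
  by move=> z _ /=; rewrite lee_fin (le_trans (c1 z))// ler_norm.
have Fi2 : Q.-integrable setT ((EFin \o c) \o F2).
  apply: (le_integrable measurableT _ _ cKi2) => //; first exact: measurableT_comp.
  by move=> z _ /=; rewrite lee_fin (le_trans (c2 z))// ler_norm.
have Ei : Q.-integrable setT (EFin \o \1_E).
  have [i1 _] := integral_comp_fst
    (finite_measure_integrable_cst P 1 measurableT).
  apply: (le_integrable measurableT _ _ i1) => //; first exact/measurable_EFinP.
  by move=> z _ /=; rewrite lee_fin normr1 indicE; case: (_ \in _);
    rewrite ?normr1 ?normr0.
have QE : Q E = (\int[Q]_z (EFin \o \1_E) z)%E by rewrite integral_indic// setIT.
have Efin : Q E \is a fin_num by rewrite QE; exact: integrable_fin_num.
have [nuc nucE] := nui _ mc Fi1 Fi2.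
exists nu; split => //; rewrite nucE.
have cfin : (\int[P]_x (c x)%:E \is a fin_num)%E by exact: integrable_fin_num.
have le12 : (\int[Q]_y ((EFin \o c) \o F1) y + \int[Q]_y ((EFin \o c) \o F2) y <=
   (\int[P]_x (c x)%:E + \int[P]_x (c x)%:E) - delta%:E * Q E)%E.
  have I1 := integrableD measurableT Fi1 Fi2.
  have I2 := integrableD measurableT ci1 ci2.
  have I3 := integrableZl measurableT delta Ei.
  rewrite -{1}Ic1 -Ic2 QE -(integralZl measurableT Ei).
  rewrite -(integralD measurableT Fi1 Fi2) -(integralD measurableT ci1 ci2).
  rewrite -(integralB measurableT I2 I3).
  apply: (le_integral measurableT I1 (integrableB measurableT I2 I3)).
  by move=> z _ /=; rewrite lee_fin; exact: c12.
apply: (@le_lt_trans _ _ ((2^-1)%:E *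
  ((\int[P]_x (c x)%:E + \int[P]_x (c x)%:E) - delta%:E * Q E))%E).
  by rewrite lee_pmul2l// lte_fin invr_gt0.
move: E0; rewrite -[X in (0 < X)%E]/(Q E).
rewrite -(fineK cfin) -(fineK Efin) -!(EFinD, EFinN, EFinM) !lte_fin => E0.
have := mulr_gt0 d0 E0; lra.
Qed.

(** * Exchanging a block of coordinates between two points *)

Section Mix.
Context {m : nat} {M : 'I_m -> ptopologicalType}.
Local Notation X := (prod_topology M).

Definition mix (p : {set 'I_m}) (u v : X) : X :=
  fun i => if i \in p then u i else v i.

Lemma mix_continuous (p : {set 'I_m}) :
  continuous (fun z : X * X => mix p z.1 z.2).
Proof.
move=> z; apply: prod_cvg => i.
suff : {for z, continuous (fun z : X * X => mix p z.1 z.2 i)} by [].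
rewrite /mix; case: (i \in p).
- apply: (@continuous_comp _ _ _ fst (fun u : X => u i)); first exact: cvg_fst.
  exact: prod_proj_continuous.
- apply: (@continuous_comp _ _ _ snd (fun u : X => u i)); first exact: cvg_snd.
  exact: prod_proj_continuous.
Qed.

Lemma measurable_open (T : ptopologicalType) (U : set T) :
  open U -> measurable (U : set (borel T)).
Proof. by move=> oU; exact: sub_sigma_algebra. Qed.

Lemma open_box (J : {set 'I_m}) (U : forall i, set (M i)) :
  (forall i, open (U i)) -> open [set u : X | forall i, i \in J -> U i (u i)].
Proof.
move=> oU; rewrite openE => u Uu; apply/prod_nbhs_box.
exists (fun i => if i \in J then U i else setT); split=> [i|z Uz i iJ].
  case: ifP => iJ; last exact: filterT.
  by apply: open_nbhs_nbhs; split; [exact: oU|exact: Uu].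
by have := Uz i; rewrite iJ.
Qed.

(** Continuity does not suffice directly, because the source carries the product of the two Borel
    sigma-algebras. By second countability an open set is a countable union of boxes, and the
    preimage of a box is a measurable rectangle. *)
Lemma measurable_mix (p : {set 'I_m}) :
  (forall i, @second_countable (M i)) ->
  measurable_fun [set: borel X * borel X]
    (fun z => mix p z.1 z.2 : borel X).
Proof.
move=> cM; have [B [Bbox Bopen]] := prod_second_countable cM.
apply: (@measurability _ _ _ (borel X) _ _ (@open X)) => // _ [V oV <-].
rewrite setTI (Bopen V oV) preimage_bigcup.
apply: bigcup_measurable => k _; have [U [oU ->]] := Bbox k.
rewrite (_ : _ @^-1` _ =
  [set u : X | forall i, i \in p -> U i (u i)] `*`
  [set v : X | forall i, i \in (~: p)%SET -> U i (v i)]).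
  by apply: measurableX; apply: measurable_open; apply: open_box.
rewrite eqEsubset /mix; split=> -[u v] /=.
  move=> Uuv; split=> i; rewrite ?inE => ip; have := Uuv i; first by rewrite ip.
  by rewrite (negbTE ip).
by move=> [Uu Uv] i; case: ifPn => ip; [exact: Uu|apply: Uv; rewrite inE].
Qed.

End Mix.

(** Normalizing a measure of mass one changes nothing, but yields an object of type [probability],
    to which the product measure results apply. *)
Lemma measure_probability d (T : measurableType d) (R : realType)
    (mu : {measure set T -> \bar R}) : mu setT = 1%E ->
  exists P : probability T R, (P : set T -> \bar R) = mu.
Proof.
move=> mu1; exists (mnormalize mu (\d_ point)).
apply/funext => A.
by rewrite /= /mnormalize mu1/= onee_eq0 /= invr1 mule1.
Qed.

(** * The swap inequality on the support of an optimizer *)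

Section Monotone.
Context {R : realType} {m : nat} {M : 'I_m -> ptopologicalType}.
Local Notation X := (prod_topology M).

Lemma measurable_proj (i : 'I_m) :
  measurable_fun [set: borel X] (fun x : borel X => x i : borel (M i)).
Proof.
apply: (@measurability _ _ _ (borel (M i)) _ _ (@open (M i))) => // _ [V oV <-].
rewrite setTI; apply: measurable_open.
by apply: open_comp oV => x _; exact: prod_proj_continuous.
Qed.

(** If [U] were null, its complement would be a closed set of full mass, hence would contain the
    support and the point [x] of [U]. *)
Lemma spt_gt0 (T : ptopologicalType) (gamma : {measure set (borel T) -> \bar R})
    (x : T) (U : set T) : spt gamma x -> open U -> U x -> (0 < gamma U)%E.
Proof.
move=> xg oU Ux; rewrite lt0e measure_ge0 andbT; apply/eqP => U0.
have /(_ (~` U)) : forall F : set T, closed F /\ gamma (~` F) = 0%E -> F x.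
  by move=> F hF; exact: (xg F hF).
by apply => //; split; [exact: open_closedC|rewrite setCK].
Qed.

Lemma spt_closed (T : ptopologicalType)
  (gamma : {measure set (borel T) -> \bar R}) : closed (spt gamma).
Proof. by apply: closed_bigI => F []. Qed.

Lemma marginals_probability (i : 'I_m)
    (mu : forall i, probability (borel (M i)) R)
    (gamma : {measure set (borel X) -> \bar R}) :
  has_marginals mu gamma -> gamma setT = 1%E.
Proof.
by move=> /(_ i setT measurableT); rewrite /pushforward preimage_setT probability_setT.
Qed.

(** This preserves the marginals of the competitor: in a swapped coordinate each of the two laws may
    change, but their sum does not. *)
Lemma measure_swap d (Y : measurableType d) (Q : {measure set Y -> \bar R})
    (E A B : set Y) : measurable E -> measurable A -> measurable B ->
  (Q ((E `&` B) `|` (~` E `&` A)) + Q ((E `&` A) `|` (~` E `&` B)) =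
   Q A + Q B)%E.
Proof.
move=> mE mA mB; have mE' := measurableC mE.
have disj (S S' : set Y) : (E `&` S) `&` (~` E `&` S') = set0.
  by rewrite setIACA setICr set0I.
rewrite !measureU//; try exact: measurableI.
rewrite (measureDI Q mA mE) (measureDI Q mB mE).
rewrite !setDE ![_ `&` E]setIC ![_ `&` ~` E]setIC.
by rewrite [X in (X + _)%E]addeC addeACA; congr (_ + _)%E; exact: addeC.
Qed.

Lemma spt_monotone (c : X -> R) (mu : forall i, probability (borel (M i)) R)
    (gamma : {measure set (borel X) -> \bar R}) (p : {set 'I_m}) (x y : X) :
  (0 < m)%N -> (forall i, @second_countable (M i)) -> continuous c ->
  optimizer c mu gamma -> cost_finite c gamma ->
  spt gamma x -> spt gamma y ->
  c x + c y <= c (mix p x y) + c (mix p y x).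
Proof.
move=> m0 cM cc [gmarg gopt] gfin xg yg.
have gT : gamma setT = 1%E by exact: (marginals_probability (Ordinal m0) gmarg).
have [P Pg] := measure_probability gT.
rewrite /cost_finite -Pg in gfin.
have PT : P setT = 1%E by rewrite probability_setT.
rewrite leNgt; apply/negP => lt_c.
(* The assumed gap is [5 * e]. Near [(x, y)] four values of [c] vary by less than [e] each, which
   leaves a gain of at least [e]. *)
pose e := (c x + c y - (c (mix p x y) + c (mix p y x))) / 5.
have e0 : 0 < e by rewrite divr_gt0// subr_gt0.
have cmix q (u v : X) : \forall z \near (u, v), `|c (mix q z.1 z.2) -
  c (mix q u v)| < e.
  have : {for (u, v), continuous (c \o (fun z : X * X => mix q z.1 z.2))}.
    by apply: continuous_comp; [exact: mix_continuous|exact: cc].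
  by move/cvgrPdist_lt => /(_ e e0); apply: filterS => z; rewrite distrC.
have cnear (u : X) : \forall z \near u, `|c z - c u| < e.
  by have /cvgrPdist_lt/(_ e e0) := cc u; apply: filterS => z; rewrite distrC.
have [[U1 V1] /= [xU1 yV1] UV1] := cmix p x y.
have [[V2 U2] /= [yV2 xU2] UV2] := cmix p y x.
pose U := interior (U1 `&` U2 `&` [set z | `|c z - c x| < e]).
pose V := interior (V1 `&` V2 `&` [set z | `|c z - c y| < e]).
have Ux : U x by do ![apply: filterI => //]; exact: cnear.
have Vy : V y by do ![apply: filterI => //]; exact: cnear.
have oU : open U by exact: open_interior.
have oV : open V by exact: open_interior.
have UVP u v : U u -> V v -> [/\ `|c (mix p u v) - c (mix p x y)| < e,
    `|c (mix p v u) - c (mix p y x)| < e, `|c u - c x| < e & `|c v - c y| < e].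
  move=> /interior_subset[[Uu1 Uu2] Uu3] /interior_subset[[Vv1 Vv2] Vv3].
  by split=> //; [exact: (UV1 (u, v))|exact: (UV2 (v, u))].
have mU : measurable (U : set (borel X)) by exact: measurable_open.
have mV : measurable (V : set (borel X)) by exact: measurable_open.
pose E : set (borel X * borel X) := U `*` V.
have mE : measurable E by exact: measurableX.
have mmem : measurable_fun [set: borel X * borel X] (fun z => z \in E).
  apply: (@measurable_fun_bool _ _ _ _ true); rewrite setTI.
  by rewrite (_ : _ @^-1` _ = E)//; apply/seteqP; split=> z /= => [/set_mem|/mem_set].
have mm := measurable_mix p cM.
pose F1 (z : borel X * borel X) : borel X :=
  if z \in E then mix p z.1 z.2 else z.1.
pose F2 (z : borel X * borel X) : borel X :=
  if z \in E then mix p z.2 z.1 else z.2.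
have mF1 : measurable_fun [set: borel X * borel X] F1.
  by apply: measurable_fun_ifT => //; exact: measurable_fst.
have mF2 : measurable_fun [set: borel X * borel X] F2.
  apply: measurable_fun_ifT => //.
  by have := measurableT_comp mm (@measurable_swap _ _ (borel X) (borel X)).
have mproj := measurable_proj.
(* On [E] the swapped points have costs within [e] of [c (mix p x y)] and [c (mix p y x)], hence
   bounded by [K]; off [E] nothing moves. *)
pose K := `|c (mix p x y)| + `|c (mix p y x)| + e.
have K0 : 0 <= K by rewrite !addr_ge0// ltW.
have cF1 z : `|c (F1 z)| <= `|c z.1| + K.
  rewrite /F1; case: ifPn => [|_]; last by rewrite lerDl.
  rewrite inE => -[Uz Vz]; have [+ _ _ _] := UVP _ _ Uz Vz.
  rewrite /K; have := lerB_dist (c (mix p z.1 z.2)) (c (mix p x y)).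
  have := normr_ge0 (c z.1); have := normr_ge0 (c (mix p y x)).
  lra.
have cF2 z : `|c (F2 z)| <= `|c z.2| + K.
  rewrite /F2; case: ifPn => [|_]; last by rewrite lerDl.
  rewrite inE => -[Uz Vz]; have [_ + _ _] := UVP _ _ Uz Vz.
  rewrite /K; have := lerB_dist (c (mix p z.2 z.1)) (c (mix p y x)).
  have := normr_ge0 (c z.2); have := normr_ge0 (c (mix p x y)).
  lra.
have cF12 z : c (F1 z) + c (F2 z) <= c z.1 + c z.2 - e * \1_E z.
  rewrite /F1 /F2 indicE; case: ifPn => [|_]; last by rewrite mulr0 subr0.
  rewrite inE => -[Uz Vz]; have [] := UVP _ _ Uz Vz.
  by rewrite !ltr_norml /e mulr1 => /andP[? ?] /andP[? ?] /andP[? ?] /andP[? ?]; lra.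
have PE : (0 < (P \x P)%E E)%E.
  rewrite product_measure1E// -[X in (_ < X)%E]/(P U * P V)%E Pg.
  by rewrite mule_gt0//; [exact: (spt_gt0 xg oU Ux)|exact: (spt_gt0 yg oV Vy)].
have [nu [nuE nui nulc]] := swap_cost_lt mF1 mF2 mE gfin cF1 cF2 e0 cF12 PE.
have : (cost c gamma <= cost c nu)%E.
  apply: gopt; last first.
    by left; rewrite ltey_eq integrable_pos_fin_num.
  move=> i B mB; rewrite -gmarg // /pushforward nuE.
  set A := (fun x : borel X => x i : borel (M i)) @^-1` B.
  have mA : measurable A by rewrite -[A]setTI; exact: mproj.
  pose Q : {measure set (borel X * borel X) -> \bar R} := (P \x P)%E.
  have QT : Q setT = 1%E.
    by rewrite -setXTT [LHS]product_measure1E// -[LHS]/(P setT * P setT)%E PT mule1.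
  have Q1 : Q (fst @^-1` A) = gamma A.
    rewrite (_ : fst @^-1` A = A `*` setT); last by apply/seteqP; split=> z //= [].
    by rewrite [LHS]product_measure1E// -[LHS]/(P A * P setT)%E PT Pg mule1.
  have Q2 : Q (snd @^-1` A) = gamma A.
    rewrite (_ : snd @^-1` A = setT `*` A); last by apply/seteqP; split=> z //= [].
    by rewrite [LHS]product_measure1E// -[LHS]/(P setT * P A)%E PT Pg mul1e.
  have Afin : gamma A \is a fin_num.
    by rewrite ge0_fin_numE// -Pg (le_lt_trans (probability_le1 P mA)) ?ltry.
  suff -> : (Q (F1 @^-1` A) + Q (F2 @^-1` A) = gamma A + gamma A)%E.
    by rewrite -(fineK Afin) -!(EFinD, EFinM); congr EFin; lra.
  have m1 : measurable (fst @^-1` A : set (borel X * borel X)).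
    by rewrite -[_ @^-1` _]setTI; exact: measurable_fst.
  have m2 : measurable (snd @^-1` A : set (borel X * borel X)).
    by rewrite -[_ @^-1` _]setTI; exact: measurable_snd.
  (* For [i] in [p] the [i]-th coordinates of [F1] and [F2] are always those of the first and second
     point. Otherwise they are exchanged exactly on [E], and [measure_swap] applies. *)
  have [ip|ip] := boolP (i \in p).
    rewrite -{1}Q1 -Q2; congr (Q _ + Q _)%E; apply/seteqP; split=> z;
      by rewrite /A /F1 /F2 /mix /=; case: (z \in E); rewrite ?ip.
  rewrite -{1}Q1 -Q2 -(measure_swap Q mE m1 m2).
  congr (Q _ + Q _)%E; apply/seteqP; split=> z; rewrite /A /F1 /F2 /mix /=;
    case: ifPn; rewrite ?(negbTE ip) ?inE ?notin_setE => zE.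
  - by left.
  - by right.
  - by case=> -[].
  - by case=> -[].
  - by left.
  - by right.
  - by case=> -[].
  - by case=> -[].
by rewrite leNgt /cost -Pg nulc.
Qed.
End Monotone.

(** * Functions of class C^k and charts *)

Lemma linear_rV_continuous {R : realType} {n : nat} {W : normedModType R}
  (f : {linear 'rV[R]_n -> W}) : continuous f.
Proof.
apply/linear_bounded_continuous/linear_boundedP.
exists (\sum_j `|f (delta_mx 0 j)|); split; first exact: num_real.
move=> r /ltW rlt u; rewrite {1}(row_sum_delta u) linear_sum.
apply: (le_trans (ler_norm_sum _ _ _)); apply: le_trans (ler_wpM2r _ rlt) => //.
rewrite mulr_suml; apply: ler_sum => j _; rewrite linearZ normrZ mulrC.
apply: ler_wpM2l => //; rewrite [leRHS]/Num.Def.normr/= mx_normrE.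
exact: (le_bigmax _ (fun ij => `|u ij.1 ij.2|) (0, j)).
Qed.

Section CkTheory.
Context {R : realType}.
Implicit Types E F G : normedModType R.

(** The first order expansion of [f] at [a] is also one of [g], and such an expansion determines the
    differential. *)
Lemma near_eq_differentiable E F (f g : E -> F) (a : E) :
  (\forall u \near a, f u = g u) -> differentiable f a -> differentiable g a.
Proof.
move=> fg df; have [dfc fE] := (diff_locallyP _ _).1 df.
have gE : g \o shift a = cst (g a) + 'd f a +o_ (0 : E) id.
  apply/eqaddoP => _/posnumP[eps].
  move/eqaddoP : fE => /(_ _ (gt0 eps)).
  apply: filterS2; last first.
    move: fg; rewrite (near_shift 0) subr0 => fg; exact: fg.
  move=> h /= gh; rewrite /= /cst /= !fctE/= -(nbhs_singleton fg) -gh//.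
by apply/diff_locallyP; rewrite (diff_unique dfc gE).
Qed.

Lemma near_in_open (T : topologicalType) (U : set T) (P : T -> Prop) (a : T) :
  open U -> U a -> (forall u, U u -> P u) -> \forall u \near a, P u.
Proof. by move=> oU Ua UP; apply: (filterS UP); exact: open_nbhs_nbhs. Qed.

(** Differentiability and derivatives are local, so functions that agree on the open set [U] have
    directional derivatives that agree there; induction on [k] follows. *)
Lemma Ck_eq E F k (U : set E) (f g : E -> F) :
  open U -> {in U, f =1 g} -> Ck k U f -> Ck k U g.
Proof.
move=> oU; elim: k f g => [|k IH] f g fg /=.
  move=> fc u uU; rewrite /continuous_at -(fg u uU).
  apply: cvg_trans (fc u uU); apply: near_eq_cvg.
  by apply: near_in_open oU (set_mem uU) _ => w Uw; rewrite fg// inE.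
move=> [df Df]; split=> [u uU|v].
  apply: near_eq_differentiable (df u uU).
  by apply: near_in_open oU (set_mem uU) _ => w Uw; rewrite fg// inE.
apply: IH (Df v) => u uU; apply: near_eq_derive.
by apply: near_in_open oU (set_mem uU) _ => w Uw; rewrite fg// inE.
Qed.

Lemma Ck_subset E F k (U V : set E) (f : E -> F) :
  V `<=` U -> Ck k U f -> Ck k V f.
Proof.
move=> VU; elim: k f => [|k IH] f /=; first by move=> fc u /[!inE] /VU Uu;
  apply: fc; rewrite inE.
move=> [df Df]; split=> [u /[!inE] /VU Uu|v]; first by apply: df; rewrite inE.
exact: IH.
Qed.

(** The induction closes because ['D_v (L \o f)] is [L \o 'D_v f], again a composite with [L]. *)
Lemma Ck_comp_linear E F G k (U : set E) (f : E -> F) (L : {linear F -> G}) :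
  open U -> continuous L -> Ck k U f -> Ck k U (L \o f).
Proof.
move=> oU cL; elim: k f => [|k IH] f /=.
  by move=> fc u uU; apply: continuous_comp; [exact: fc|exact: cL].
move=> [df Df]; split=> [u uU|v].
  by apply: differentiable_comp; [exact: df|exact: linear_differentiable].
apply: Ck_eq (IH _ (Df v)) => // u uU.
have dfu := df u uU; have dL := linear_differentiable (f u) cL.
rewrite /= deriveE// [RHS]deriveE; last exact: differentiable_comp.
by rewrite (diff_comp dfu dL) /= diff_lin.
Qed.

(** The induction closes because ['D_v (f \o L)] is ['D_(L v) f \o L], again a composite with
    [L]. *)
Lemma Ck_linear_comp E F G k (U : set F) (f : F -> G) (L : {linear E -> F}) :
  open U -> continuous L -> Ck k U f -> Ck k (L @^-1` U) (f \o L).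
Proof.
move=> oU cL; elim: k f => [|k IH] f /=.
  move=> fc u; rewrite inE => uU.
  by apply: continuous_comp; [exact: cL|apply: fc; rewrite inE].
move=> [df Df]; split=> [u /[!inE] uU|v].
  apply: differentiable_comp; first exact: linear_differentiable.
  by apply: df; rewrite inE.
apply: Ck_eq (IH _ (Df (L v))); first by apply: open_comp => // x _; exact: cL.
move=> u; rewrite inE => uU.
have dfu : differentiable f (L u) by apply: df; rewrite inE.
have dL := linear_differentiable u cL.
rewrite /= deriveE// [RHS]deriveE; last exact: differentiable_comp.
by rewrite (diff_comp dL dfu) /= diff_lin.
Qed.

Lemma Ck_add E F k (U : set E) (f g : E -> F) :
  open U -> Ck k U f -> Ck k U g -> Ck k U (fun u => f u + g u).
Proof.
move=> oU; elim: k f g => [|k IH] f g /=.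
  by move=> fc gc u uU; apply: cvgD; [exact: fc|exact: gc].
move=> [df Df] [dg Dg]; split=> [u uU|v].
  by apply: differentiableD; [exact: df|exact: dg].
apply: Ck_eq (IH _ _ (Df v) (Dg v)) => // u uU.
have dfu := df u uU; have dgu := dg u uU.
by rewrite deriveD//; exact: diff_derivable.
Qed.

Lemma Ck_cst E F k (U : set E) (a : F) : open U -> Ck k U (fun=> a).
Proof.
move=> oU; elim: k a => [|k IH] a /=; first by move=> u _; exact: cvg_cst.
split=> [u _|v]; first exact: differentiable_cst.
by apply: Ck_eq (IH 0) => // u _; rewrite derive_cst.
Qed.

Lemma Ck_sum E F (I : Type) (r : seq I) k (U : set E) (f : I -> E -> F) :
  open U -> (forall i, Ck k U (f i)) -> Ck k U (fun u => \sum_(i <- r) f i u).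
Proof.
move=> oU fk; elim: r => [|i r IH].
  apply: (@Ck_eq _ _ k U (fun=> 0)) => //; last exact: Ck_cst.
  by move=> u _; rewrite big_nil.
apply: (@Ck_eq _ _ k U (fun u => f i u + \sum_(j <- r) f j u)) => //.
  by move=> u _; rewrite big_cons.
exact: Ck_add.
Qed.

End CkTheory.

(** * Linear changes of coordinates in a chart *)

Section ChartImage.
Context {R : realType} {T : topologicalType} {n : nat}.
Implicit Types phi psi : chart R T n.

Lemma chart_image_open phi (V : set T) :
  is_chart phi -> open V -> open (cmap phi @` (cdom phi `&` V)).
Proof.
move=> [_ oimg phiK _ cinvc] oV; rewrite openE => _ [x [Dx Vx] <-].
have imgx : cimg phi (cmap phi x) by exists x.
have nimg : \forall w \near cmap phi x, cimg phi w by exact: open_nbhs_nbhs.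
have nV : \forall w \near cmap phi x, V (cinv phi w).
  apply: (cinvc _ (mem_set imgx)); rewrite phiK ?inE//.
  exact: open_nbhs_nbhs.
apply: filterS2 nimg nV => w [y Dy <-]; rewrite phiK ?inE// => Vy.
by exists y.
Qed.

Lemma chart_preimage_nbhs phi (x : T) (V : set 'rV[R]_n) :
  is_chart phi -> cdom phi x -> nbhs (cmap phi x) V ->
  nbhs x (cdom phi `&` (cmap phi @^-1` V)).
Proof.
move=> [oD _ _ cmapc _] Dx xV; apply: filterI; first exact: open_nbhs_nbhs.
by apply: (cmapc x) => //; rewrite inE.
Qed.

(** Coordinates are row vectors, so matrices act on the right. [P] is meant to be the inverse of
    [Q]; below, [Q] is the transpose of an orthogonal matrix [P] that diagonalizes [g]. *)
Definition linear_chart phi (P Q : 'M[R]_n) : chart R T n :=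
  Chart (cdom phi) (fun x => cmap phi x *m Q) (fun u => cinv phi (u *m P)).

Context {P Q : 'M[R]_n} (PQ : P *m Q = 1%:M) (QP : Q *m P = 1%:M).

Lemma linear_chart_image phi (V : set T) :
  cmap (linear_chart phi P Q) @` V = mulmxr P @^-1` (cmap phi @` V).
Proof.
rewrite eqEsubset; split=> [_ [x Vx <-]|w [x Vx xw]] /=; exists x => //=.
  by rewrite -mulmxA QP mulmx1.
by rewrite xw /= -mulmxA PQ mulmx1.
Qed.

Lemma linear_chart_is_chart phi :
  is_chart phi -> is_chart (linear_chart phi P Q).
Proof.
move=> [oD oimg phiK cmapc cinvc]; split=> //.
- rewrite /cimg linear_chart_image; apply: open_comp => // x _.
  exact: linear_rV_continuous.
- by move=> x Dx /=; rewrite -mulmxA QP mulmx1 phiK.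
- move=> x Dx /=.
  apply: (@continuous_comp _ _ _ (cmap phi) (mulmxr Q)); first exact: cmapc.
  exact: linear_rV_continuous.
- move=> u; rewrite inE /cimg linear_chart_image => uP /=.
  apply: (@continuous_comp _ _ _ (mulmxr P) (cinv phi)).
    exact: linear_rV_continuous.
  by apply: cinvc; rewrite inE.
Qed.

Lemma linear_chart_compatible phi psi :
  is_chart phi -> is_chart psi -> compatible psi phi ->
  compatible psi (linear_chart phi P Q).
Proof.
move=> cphi cpsi [psiphi phipsi].
have [ophi _ _ _ _] := cphi; have [opsi _ _ _ _] := cpsi.
split=> k.
  apply: (@Ck_comp_linear _ _ _ _ k _ _ (mulmxr Q)) (psiphi k).
    exact: chart_image_open.
  exact: linear_rV_continuous.
rewrite linear_chart_image.
apply: (@Ck_linear_comp _ _ _ _ k _ _ (mulmxr P)) (phipsi k).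
  exact: chart_image_open.
exact: linear_rV_continuous.
Qed.

End ChartImage.

(** * Product charts *)

Section ProdChart.
Context {R : realType} {m : nat} {n : 'I_m -> nat}.
Context {M : 'I_m -> ptopologicalType}.
Local Notation N := (\sum_i n i)%N.
Local Notation X := (prod_topology M).

(** Writing a concatenation as a sum of linear images of its blocks reduces continuity and
    smoothness of product maps to the linear case. *)
Lemma mxrowE_sum (w : forall i, 'rV[R]_(n i)) :
  \mxrow_i w i = \sum_i w i *m submxcol (1%:M : 'M[R]_N) i.
Proof. by rewrite -mul_mxrow_mxcol submxcolK mulmx1. Qed.

Lemma submxrowE (u : 'rV[R]_N) i : submxrow u i = u *m submxrow 1%:M i.
Proof. by rewrite mul_submxrow mulmx1. Qed.

Lemma submxrow_continuous i : continuous (fun u : 'rV[R]_N => submxrow u i).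
Proof.
rewrite (_ : (fun _ => _) = mulmxr (submxrow 1%:M i)).
  exact: linear_rV_continuous.
by apply/funext => u; rewrite submxrowE.
Qed.

Lemma mxrow_cvg (U : Type) (F : set_system U) (w : U -> forall i, 'rV[R]_(n i))
    (l : forall i, 'rV[R]_(n i)) : Filter F ->
  (forall i, (fun x => w x i) @ F --> l i) ->
  (fun x => \mxrow_i w x i) @ F --> (\mxrow_i l i : 'rV[R]_N).
Proof.
move=> FF wl; rewrite mxrowE_sum.
rewrite (_ : (fun _ => _) =
  (fun x => \sum_i mulmxr (submxcol (1%:M : 'M[R]_N) i) (w x i))).
  apply: cvg_big => [|i _]; first exact: add_continuous.
  apply: (@cvg_comp _ _ _ (w ^~ i) (mulmxr (submxcol 1%:M i)) _ (nbhs (l i))).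
    exact: wl.
  exact: (@linear_rV_continuous R _ _ (mulmxr (submxcol 1%:M i)) (l i)).
by apply/funext => x; rewrite mxrowE_sum.
Qed.

Lemma prod_chart_image (phi : forall i, chart R (M i) (n i))
    (V : forall i, set (M i)) :
  cmap (prod_chart phi) @` [set x : X | forall i, V i (x i)] =
  [set u | forall i, (cmap (phi i) @` V i) (submxrow u i)].
Proof.
rewrite eqEsubset; split=> [_ [x Vx <-] i /=|u uV].
  by rewrite mxrowK; exists (x i).
have ex i : exists y, V i y /\ cmap (phi i) y = submxrow u i.
  by have [y Vy yu] := uV i; exists y.
exists (fun i => projT1 (cid (ex i))) => /=.
  by move=> i; exact: (projT2 (cid (ex i))).1.
rewrite -[RHS]submxrowK; apply/eq_mxrow => i.
exact: (projT2 (cid (ex i))).2.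
Qed.

Lemma open_submxrow (V : forall i, set 'rV[R]_(n i)) :
  (forall i, open (V i)) -> open [set u : 'rV[R]_N | forall i, V i (submxrow u i)].
Proof.
move=> oV; rewrite openE => u Vu.
apply: (@filter_forall _ _ (fun i (w : 'rV[R]_N) => V i (submxrow w i)) (nbhs u)) => i.
by apply: (submxrow_continuous (i := i)); exact: open_nbhs_nbhs.
Qed.

Lemma prod_chart_is_chart (phi : forall i, chart R (M i) (n i)) :
  (forall i, is_chart (phi i)) -> is_chart (prod_chart phi).
Proof.
move=> cphi; split.
- rewrite /= (_ : [set x : X | _] =
  [set x : X | forall i, i \in [set: 'I_m]%SET -> cdom (phi i) (x i)]).
    apply: (@open_box _ M [set: 'I_m]%SET (fun i => cdom (phi i))) => i.
    by have [] := cphi i.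
  by apply/seteqP; split=> x h i; [move=> _|]; apply: h; rewrite ?inE.
- rewrite /cimg (prod_chart_image phi (fun i => cdom (phi i))).
  by apply: (@open_submxrow (fun i => cimg (phi i))) => i; have [] := cphi i.
- move=> x; rewrite inE => Dx; apply/functional_extensionality_dep => i /=.
  by rewrite mxrowK; have [_ _ + _ _] := cphi i; apply; rewrite inE; exact: Dx.
- move=> x; rewrite inE => Dx.
  apply: (@mxrow_cvg _ (nbhs x) (fun (z : X) i => cmap (phi i) (z i))
    (fun i => cmap (phi i) (x i))) => i.
  have [_ _ _ + _] := cphi i; move=> /(_ (x i) (mem_set (Dx i))) h.
  apply: (@continuous_comp _ _ _ (fun x : X => x i) (cmap (phi i))) => //.
  exact: prod_proj_continuous.
- move=> u; rewrite inE /cimg (prod_chart_image phi (fun i => cdom (phi i))).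
  move=> uD; have FF := fmap_filter (cinv (prod_chart phi)) (nbhs_filter u).
  apply: (@prod_cvg _ M (fmap (cinv (prod_chart phi)) (nbhs u))) => i.
  have [_ _ _ _ +] := cphi i => /(_ _ (mem_set (uD i))) h.
  have hu : {for u, continuous (fun u : 'rV[R]_N => submxrow u i)}.
    exact: submxrow_continuous.
  exact: (continuous_comp hu h).
Qed.

(** The transition map is the sum over [i] of: extract block [i], apply the transition of factor
    [i], embed the result as block [i]. The outer two maps are linear. *)
Lemma prod_chart_transition (phi psi : forall i, chart R (M i) (n i)) :
  (forall i, is_chart (phi i)) -> (forall i, is_chart (psi i)) ->
  (forall i, smooth_transition (phi i) (psi i)) ->
  smooth_transition (prod_chart phi) (prod_chart psi).
Proof.
move=> cphi cpsi sm k.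
pose V i := cmap (phi i) @` (cdom (phi i) `&` cdom (psi i)).
have oV i : open (V i).
  by apply: chart_image_open; [exact: cphi|have [] := cpsi i].
rewrite (_ : _ @` _ = [set u | forall i, V i (submxrow u i)]); last first.
  rewrite -(prod_chart_image phi (fun i => cdom (phi i) `&` cdom (psi i))).
  congr (_ @` _); apply/seteqP; split=> x /=; first by move=> [? ?] i; split.
  by move=> h; split=> i; have [] := h i.
pose f i := cmap (psi i) \o cinv (phi i).
pose g i (u : 'rV[R]_N) := mulmxr (submxcol (1%:M : 'M[R]_N) i)
  (f i (mulmxr (submxrow 1%:M i) u)).
apply: (@Ck_eq _ _ _ k _ (fun u => \sum_i g i u)).
- exact: (@open_submxrow V).
- move=> u _ /=; rewrite mxrowE_sum; apply: eq_bigr => i _.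
  by rewrite /g /f /= -submxrowE.
apply: Ck_sum => [|i]; first exact: (@open_submxrow V).
apply: (@Ck_subset _ _ _ k (mulmxr (submxrow 1%:M i) @^-1` V i)).
  by move=> u /(_ i) /=; rewrite -submxrowE.
apply: (@Ck_linear_comp _ _ _ _ k (V i)
  (mulmxr (submxcol (1%:M : 'M[R]_N) i) \o f i)
  (mulmxr (submxrow 1%:M i))).
- exact: oV.
- exact: linear_rV_continuous.
apply: (@Ck_comp_linear _ _ _ _ k (V i) (f i) (mulmxr (submxcol 1%:M i))).
- exact: oV.
- exact: linear_rV_continuous.
- exact: sm.
Qed.

(** This provides the local coordinates demanded by [lipschitz_submanifold]: invertible linear
    changes of product charts stay in the maximal atlas. *)
Lemma linear_prod_chart_smooth (A : forall i, smooth_structure R (M i) (n i))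
    (phi : forall i, chart R (M i) (n i)) (P Q : 'M[R]_N) :
  P *m Q = 1%:M -> Q *m P = 1%:M -> in_atlases A phi ->
  smooth_chart (prod_atlas A) (linear_chart (prod_chart phi) P Q).
Proof.
move=> PQ QP Aphi.
have cA psi : in_atlases A psi -> is_chart (prod_chart psi).
  by move=> Apsi; apply: prod_chart_is_chart => i; exact: atlas_chart (Apsi i).
split; first by apply: linear_chart_is_chart => //; exact: cA.
move=> _ [psi Apsi <-].
apply: linear_chart_compatible => //; [exact: cA|exact: cA|].
have cc i : compatible (psi i) (phi i).
  exact: (atlas_compatible (Apsi i) (Aphi i)).
split; apply: prod_chart_transition => i; try exact: atlas_chart (Aphi i);
  try exact: atlas_chart (Apsi i); by have [] := cc i.
Qed.

Lemma Ck_manifold_continuous (A : forall i, smooth_structure R (M i) (n i))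
    (c : X -> R) k : Ck_manifold (prod_atlas A) k.+1 c -> continuous c.
Proof.
move=> hc x.
have ex i : exists phi, atlas (A i) phi /\ cdom phi (x i).
  by have [phi ? ?] := atlas_cover (A i) (x i); exists phi.
pose phi i := projT1 (cid (ex i)).
have Aphi : in_atlases A phi by move=> i; exact: (projT2 (cid (ex i))).1.
have Dx : cdom (prod_chart phi) x by move=> i; exact: (projT2 (cid (ex i))).2.
have cphi : is_chart (prod_chart phi).
  by apply: prod_chart_is_chart => i; exact: atlas_chart (Aphi i).
have [oD _ phiK cmapc _] := cphi.
have [dc _] : Ck k.+1 (cimg (prod_chart phi)) (c \o cinv (prod_chart phi)).
  by apply: hc; exists phi.
have ux : cmap (prod_chart phi) x \in cimg (prod_chart phi) by rewrite inE; exists x.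
rewrite /continuous_at; have -> : c x =
  (c \o cinv (prod_chart phi)) (cmap (prod_chart phi) x).
  by rewrite /comp phiK// inE.
apply: cvg_trans; last first.
  apply: (@continuous_comp _ _ _ (cmap (prod_chart phi))
    (c \o cinv (prod_chart phi)) x).
    by apply: cmapc; rewrite inE.
  exact: differentiable_continuous (dc _ ux).
apply: near_eq_cvg; apply: near_in_open oD Dx _ => y Dy.
by rewrite /comp phiK// inE.
Qed.

End ProdChart.

(** * Second order estimate *)

Section DoubleDifference.
Context {R : realType} {V : normedModType R}.

Lemma MVT_line (g : V -> R) (a v : V) :
  (forall t, 0 <= t <= 1 -> differentiable g (a + t *: v)) ->
  exists2 t, 0 <= t <= 1 & g (a + v) - g a = 'D_v g (a + t *: v).
Proof.
move=> dg.
have dl (t : R) : is_diff t (fun s : R => a + s *: v) (fun s : R => s *: v).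
  rewrite (_ : (fun s : R => s *: v) = 0 + (fun s : R => s *: v)).
    exact: is_diffD.
  by apply/funext => s; rewrite !fctE add0r.
have dphi (t : R) : 0 <= t <= 1 -> is_derive t 1 (fun s =>
  g (a + s *: v)) ('D_v g (a + t *: v)).
  move=> t01; have dgt := dg t t01.
  have dlt : differentiable (fun s : R => a + s *: v) t by [].
  have dcomp : differentiable (g \o (fun s : R => a + s *: v)) t.
    exact: differentiable_comp.
  apply: DeriveDef; first exact: diff_derivable.
  rewrite deriveE// (diff_comp dlt dgt) /= deriveE//.
  by rewrite (@diff_val _ _ _ _ _ _ _ (dl t)) scale1r.
have [t t01 E] : exists2 t, t \in `[0, 1]%R &
    g (a + 1 *: v) - g (a + 0 *: v) = 'D_v g (a + t *: v) * (1 - 0).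
  apply: (@MVT_segment R (fun s => g (a + s *: v)) (fun t => 'D_v g (a + t *: v))).
  - exact: ler01.
  - by move=> t /[!in_itv]/= /andP[t0 t1]; apply: dphi; rewrite !ltW.
  - apply: derivable_within_continuous => t /[!in_itv]/= t01.
    by have := dphi t t01; move=> h; exact: ex_derive.
exists t; first by move: t01; rewrite in_itv.
by move: E; rewrite scale1r scale0r addr0 subr0 mulr1.
Qed.

(** The mean value theorem is used twice: along [k] for the increment [g u = f (u + h) - f u], then
    along [h] for ['D_k f]. *)
Lemma double_difference (U : set V) (f : V -> R) (a h k : V) :
  Ck 2 U f ->
  (forall s t, 0 <= s <= 1 -> 0 <= t <= 1 -> U (a + s *: h + t *: k)) ->
  exists s t, [/\ 0 <= s <= 1, 0 <= t <= 1 &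
    f (a + h + k) - f (a + h) - (f (a + k) - f a) =
    'D_h ('D_k f) (a + s *: h + t *: k)].
Proof.
move=> [df Df] Uh.
have I0 : (0 <= (0 : R) <= 1) by rewrite lexx ler01.
have I1 : (0 <= (1 : R) <= 1) by rewrite lexx ler01.
pose g u := f (u + h) - f u.
have dfh t : 0 <= t <= 1 -> differentiable (fun u => f (u + h)) (a + t *: k).
  move=> t01; apply: (@differentiable_comp _ _ _ _ (fun u => u + h) f).
    exact: differentiableD.
  by apply: df; rewrite inE addrAC -[h]scale1r; exact: Uh.
have df0 t : 0 <= t <= 1 -> differentiable f (a + t *: k).
  move=> t01; apply: df; rewrite inE -[a]addr0 -(scale0r h); exact: Uh.
have [t t01 gE] : exists2 t, 0 <= t <= 1 & g (a + k) - g a = 'D_k g (a + t *: k).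
  by apply: MVT_line => t t01; apply: differentiableB; [exact: dfh|exact: df0].
have dDf s : 0 <= s <= 1 -> differentiable ('D_k f) (a + t *: k + s *: h).
  by move=> s01; apply: (Df k).1; rewrite inE addrAC; exact: Uh.
have [s s01 DE] := MVT_line dDf.
exists s, t; split; [exact: s01|exact: t01|].
rewrite (addrAC a (s *: h)); apply: etrans DE.
have fhE : 'D_k (fun u => f (u + h)) (a + t *: k) = 'D_k f (a + t *: k + h).
  apply: (congr1 (fun F : R -> R => lim (F @ 0^'))).
  by apply/funext => r /=; rewrite -(addrA (r *: k) (a + t *: k) h).
rewrite -fhE -deriveB; last 2 first.
- exact: diff_derivable (dfh t t01).
- exact: diff_derivable (df0 t t01).
rewrite -[RHS]gE /g (addrAC a h k); ring.
Qed.

End DoubleDifference.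

(** * Hessians and the sign of double differences *)

Section Hessian.
Context {R : realType} {N : nat}.
Implicit Types (f : 'rV[R]_N -> R) (A : 'M[R]_N) (u v w : 'rV[R]_N).

Definition hessian f u : 'M[R]_N :=
  \matrix_(i, j) 'D_(delta_mx 0 i) ('D_(delta_mx 0 j) f) u.

Lemma hessianE f u i j :
  hessian f u i j = 'D_(delta_mx 0 i) ('D_(delta_mx 0 j) f) u.
Proof. by rewrite mxE. Qed.

Lemma mxB_entry m n (B C : 'M[R]_(m, n)) i j : (B - C) i j = B i j - C i j.
Proof. by rewrite !mxE. Qed.

Lemma bilinearE A u v :
  (u *m A *m v^T) 0 0 = \sum_i \sum_j u 0 i * A i j * v 0 j.
Proof.
rewrite mxE exchange_big/=; apply: eq_bigr => j _.
by rewrite mxE mulr_suml; apply: eq_bigr => i _; rewrite mxE.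
Qed.

Lemma mx_entry_le_norm m n (B : 'M[R]_(m, n)) i j : `|B i j| <= `|B|.
Proof.
rewrite [leRHS]/Num.Def.normr/= mx_normrE.
exact: (le_bigmax _ (fun ij => `|B ij.1 ij.2|) (i, j)).
Qed.

Lemma mx_norm_le m n (B : 'M[R]_(m, n)) r :
  0 <= r -> (forall i j, `|B i j| <= r) -> `|B| <= r.
Proof.
move=> r0 Br; rewrite [leLHS]/Num.Def.normr/= mx_normrE.
by apply: bigmax_le => // -[i j] _; exact: Br.
Qed.

Lemma bilinear_delta i j u v :
  (u *m delta_mx i j *m v^T) 0 0 = u 0 i * v 0 j.
Proof.
rewrite bilinearE (bigD1 i)//= (bigD1 j)//= mxE !eqxx mulr1.
rewrite !big1 ?addr0// => [k /negbTE kj|k /negbTE ki].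
  by rewrite big1// => l _; rewrite mxE kj mulr0 mul0r.
by rewrite mxE ki andbF mulr0 mul0r.
Qed.

Lemma bilinear_le A u v eta rho : (forall i j, `|A i j| <= eta) ->
  `|u| <= rho -> `|v| <= rho ->
  (u *m A *m v^T) 0 0 <= (N ^ 2)%:R * (eta * rho ^+ 2).
Proof.
move=> Ae ur vr; rewrite bilinearE.
apply: (@le_trans _ _ (\sum_(i < N) \sum_(j < N) eta * rho ^+ 2)); last first.
  by rewrite !sumr_const card_ord -mulrnA mulnn [leRHS]mulr_natl.
apply: ler_sum => i _; apply: ler_sum => j _.
rewrite (le_trans (ler_norm _))// !normrM.
rewrite [`|u 0 i| * _]mulrC -mulrA expr2.
apply: ler_pM => //.
by apply: ler_pM => //; exact: le_trans (mx_entry_le_norm _ _ _) _.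
Qed.

Lemma derive_row_sum f u v : differentiable f u ->
  'D_v f u = \sum_i v 0 i * 'D_(delta_mx 0 i) f u.
Proof.
move=> df; rewrite deriveE// {1}(row_sum_delta v) linear_sum.
by apply: eq_bigr => i _; rewrite linearZ /= deriveE.
Qed.

(** Near [u] the function ['D_w f] is a combination of partial derivatives with the constant
    coefficients [w 0 j]; differentiating this along [v] gives the bilinear form. *)
Lemma derive2_hessian (U : set 'rV[R]_N) f u v w :
  open U -> Ck 2 U f -> U u ->
  'D_v ('D_w f) u = (v *m hessian f u *m w^T) 0 0.
Proof.
move=> oU [df Df] Uu.
have d2 w' : differentiable ('D_w' f) u by have [d _] := Df w'; apply: d; rewrite inE.
rewrite (near_eq_derive (g := \sum_j (w 0 j \*: 'D_(delta_mx 0 j) f))); last first.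
  apply: near_in_open oU Uu _ => z Uz; rewrite derive_row_sum ?fct_sumE//.
  by apply: df; rewrite inE.
rewrite derive_sum; last by move=> j; apply: derivableZ; exact: diff_derivable.
rewrite bilinearE exchange_big; apply: eq_bigr => j _ /=.
rewrite deriveZ; last exact: diff_derivable.
rewrite derive_row_sum// /GRing.scale/= mulr_sumr; apply: eq_bigr => i _.
by rewrite hessianE; ring.
Qed.

(** By hypothesis the double difference is nonpositive, and it equals the Hessian form at an
    intermediate point [z]. Continuity of the second derivatives allows [z] to be replaced by [u0]
    at the cost of the error term. *)
Lemma hessian_estimate (U : set 'rV[R]_N) f u0 (e : R) :
  open U -> Ck 2 U f -> U u0 -> 0 < e ->
  exists2 r, 0 < r & forall a h k rho, `|a - u0| < r ->
    rho <= 2 * r -> `|h| <= rho -> `|k| <= rho ->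
    f (a + h + k) + f a <= f (a + h) + f (a + k) ->
    (h *m hessian f u0 *m k^T) 0 0 <= e * rho ^+ 2.
Proof.
move=> oU C2 Uu0 e0; have [df Df] := C2.
(* The [N ^ 2] entries contribute an error [eta * rho ^+ 2] each; the successor keeps the
   denominator positive also for [N = 0]. *)
pose eta := e / (N ^ 2).+1%:R.
have eta0 : 0 < eta by rewrite divr_gt0.
pose D2 (ij : 'I_N * 'I_N) := 'D_(delta_mx 0 ij.1) ('D_(delta_mx 0 ij.2) f).
have : \forall z \near u0, U z /\ forall ij, `|D2 ij u0 - D2 ij z| < eta.
  apply: filterI; first exact: open_nbhs_nbhs.
  apply: (@filter_forall _ _ (fun ij z => `|D2 ij u0 - D2 ij z| < eta) (nbhs u0)).
  move=> ij; have [_ /(_ (delta_mx 0 ij.1)) c2] := Df (delta_mx 0 ij.2).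
  by have /cvgrPdist_lt/(_ _ eta0) := c2 u0 (mem_set Uu0).
move=> /nbhs_ballP[d /= d0 Bd].
(* An intermediate point is at distance less than [r + 2 * rho] from [u0], which is at most
   [5 * r = d] since [rho <= 2 * r]. *)
exists (d / 5); first by rewrite divr_gt0.
move=> a h k rho au rho2 hrho krho fle.
have rho0 : 0 <= rho by exact: le_trans hrho.
have ball_line s t : 0 <= s <= 1 -> 0 <= t <= 1 ->
    ball u0 d (a + s *: h + t *: k).
  move=> /andP[s0 s1] /andP[t0 t1]; rewrite -ball_normE /= distrC.
  rewrite -[a + _ + _]addrA addrAC (le_lt_trans (ler_normD _ _))//.
  have := ler_normD (s *: h) (t *: k); rewrite !normrZ !ger0_norm//.
  have : s * `|h| <= rho by rewrite (le_trans _ hrho)// ler_piMl.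
  have : t * `|k| <= rho by rewrite (le_trans _ krho)// ler_piMl.
  move: au rho2; lra.
have [s [t [s01 t01]]] := double_difference C2 (fun s t s01 t01 =>
  (Bd _ (ball_line s t s01 t01)).1).
set z := a + s *: h + t *: k.
have [Uz Hz] := Bd _ (ball_line s t s01 t01).
rewrite (derive2_hessian _ _ oU C2 Uz) => ddE.
have le0 : (h *m hessian f z *m k^T) 0 0 <= 0 by rewrite -ddE; move: fle; lra.
suff : (h *m hessian f u0 *m k^T) 0 0 - (h *m hessian f z *m k^T) 0 0 <= e * rho ^+ 2.
  by rewrite lerBlDr => /le_trans; apply; rewrite gerDl.
rewrite (_ : _ - _ = (h *m (hessian f u0 - hessian f z) *m k^T) 0 0); last first.
  by rewrite mulmxBr mulmxBl [RHS]mxE [X in _ = _ + X]mxE.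
apply: (le_trans (bilinear_le (eta := eta) _ hrho krho)).
  move=> i j; have HD y : hessian f y i j = D2 (i, j) y by exact: hessianE.
  suff -> : (hessian f u0 - hessian f z) i j = D2 (i, j) u0 - D2 (i, j) z.
    exact: ltW (Hz (i, j)).
  by apply: etrans (mxB_entry _ _ _ _) _; congr (_ - _); exact: HD.
rewrite mulrA ler_wpM2r ?sqr_ge0//.
by rewrite /eta mulrA ler_pdivrMr// mulrC ler_pM2l// ler_nat.
Qed.

End Hessian.

(** * The form [g_p] in a product chart *)

Section QuadraticForm.
Context {R : realType} {m : nat} {n : 'I_m -> nat}.
Context {M : 'I_m -> ptopologicalType}.
Local Notation N := (\sum_i n i)%N.
Local Notation X := (prod_topology M).
Implicit Types (phi : forall i, chart R (M i) (n i)) (p q : {set 'I_m}).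
Implicit Types (w : 'rV[R]_N) (c : X -> R).

Definition block_restr p w : 'rV[R]_N :=
  \row_i (if tagnat.sig1 i \in p then w 0 i else 0).

Lemma block_restr_norm p w : `|block_restr p w| <= `|w|.
Proof.
apply: mx_norm_le => // i j; rewrite [i]ord1 mxE; case: ifP => _.
  exact: mx_entry_le_norm.
by rewrite normr0.
Qed.

Lemma block_restrDC p w : block_restr p w + block_restr (~: p)%SET w = w.
Proof.
apply/rowP => i; rewrite !mxE finset.inE.
by case: (_ \in p); rewrite ?addr0 ?add0r.
Qed.

Lemma sum_blocks p (F : 'I_N -> R) :
  \sum_(j in p) \sum_(a < n j) F (tagnat.Rank j a) =
  \sum_(i | tagnat.sig1 i \in p) F i.
Proof.
rewrite sig_big_dep/= (reindex _ (onW_bij _ (@tagnat.sig_bij _ _)))/=.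
apply: eq_big => i; first by rewrite andbT.
by move=> _; congr F; exact: tagnat.sig2K.
Qed.

(** Each symmetrized elementary matrix contributes twice the product of two coordinates of [w], one
    in a block of [p] and one in a block of [q]. Thus [g_p(w, w)] is twice the Hessian form at the
    two block restrictions of [w]. *)
Lemma gp_mx_quad c phi (x : X) p q w :
  (w *m gp_mx c phi x p q *m w^T) 0 0 =
  2 * (block_restr p w
       *m hessian (c \o cinv (prod_chart phi)) (cmap (prod_chart phi) x)
       *m (block_restr q w)^T) 0 0.
Proof.
set H := hessian _ _.
have quad_sum (I : finType) (P : pred I) (A : I -> 'M[R]_N) :
    (w *m (\sum_(i | P i) A i) *m w^T) 0 0 =
    \sum_(i | P i) (w *m A i *m w^T) 0 0.
  by rewrite mulmx_sumr mulmx_suml summxE.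
rewrite /gp_mx quad_sum.
transitivity (\sum_(j in p) \sum_(k in q) \sum_(a < n j) \sum_(b < n k)
    2 * (w 0 (tagnat.Rank j a) * H (tagnat.Rank j a) (tagnat.Rank k b) *
         w 0 (tagnat.Rank k b))).
  apply: eq_bigr => j _; rewrite quad_sum; apply: eq_bigr => k _.
  rewrite quad_sum; apply: eq_bigr => a _; rewrite quad_sum.
  apply: eq_bigr => b _; rewrite -scalemxAr -scalemxAl mxE mulmxDr mulmxDl mxE.
  rewrite !bilinear_delta /H mxE /mixed_partial /coord_vec.
  by set D := 'D__ _ _; ring.
rewrite bilinearE big_distrr/=.
transitivity (\sum_(i | tagnat.sig1 i \in p) \sum_(l | tagnat.sig1 l \in q)
    2 * (w 0 i * H i l * w 0 l)).
  rewrite -sum_blocks; apply: eq_bigr => j _.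
  rewrite exchange_big/=; apply: eq_bigr => a _.
  by rewrite -sum_blocks.
rewrite [RHS](bigID (fun i => tagnat.sig1 i \in p))/= [X in _ + X]big1 ?addr0.
  apply: eq_bigr => i ip; rewrite big_distrr/=.
  rewrite [RHS](bigID (fun i => tagnat.sig1 i \in q))/= [X in _ + X]big1 ?addr0.
    by apply: eq_bigr => l lq; rewrite !mxE ip lq; ring.
  by move=> l /negbTE lq; rewrite [block_restr q w _ _]mxE lq !mulr0.
move=> i /negbTE ip; rewrite big1 ?mulr0// => l _.
by rewrite [block_restr p w _ _]mxE ip !mul0r.
Qed.

(** In coordinates, the two points and the two swapped points are therefore the vertices of a
    parallelogram, and the swap inequality concerns a double difference. *)
Lemma cmap_mix phi p (x y : X) :
  cmap (prod_chart phi) (mix p x y) =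
  cmap (prod_chart phi) y +
  block_restr p (cmap (prod_chart phi) x - cmap (prod_chart phi) y).
Proof.
apply/rowP => i; rewrite !mxE /mix; case: ifP => _; last by rewrite addr0.
by rewrite addrC subrK.
Qed.

Lemma mix_in_prod_chart phi p (x y : X) :
  cdom (prod_chart phi) x -> cdom (prod_chart phi) y ->
  cdom (prod_chart phi) (mix p x y).
Proof. by move=> Dx Dy i; rewrite /mix; case: ifP. Qed.

End QuadraticForm.

(** As [p] has two elements, [a] and [b] are distinct blocks of a partition, hence disjoint, and
    together they cover everything. *)
Lemma bipartition_complement m (p : {set {set 'I_m}}) (a b : {set 'I_m}) :
  p \in bipartitions m -> p = [set a; b]%SET -> b = (~: a)%SET.
Proof.
rewrite finset.inE => /andP[pp /eqP cp] pE.
have ab : a != b.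
  by apply: contra_eqN cp => /eqP ab; rewrite pE ab finset.setUid cards1.
case/and3P: pp => /eqP cov /finset.trivIsetP tri _.
have dab : [disjoint a & b]%B by apply: tri; rewrite // pE !finset.inE eqxx ?orbT.
have cov' : (a :|: b)%SET = [set: 'I_m]%SET.
  by rewrite -cov /finset.cover pE finset.bigcup_setU !finset.big_set1.
apply/setP => i; rewrite finset.inE.
have := finset.in_setT i; rewrite -cov' finset.inE.
by case: (boolP (i \in a)) => ia //= _; exact: (disjointFr dab ia).
Qed.

Section LocalEstimate.
Context {R : realType} {m : nat} {n : 'I_m -> nat}.
Context {M : 'I_m -> ptopologicalType}.
Local Notation N := (\sum_i n i)%N.
Local Notation X := (prod_topology M).

(** For each [p], [hessian_estimate] is applied at the coordinates of [z], with [h] and [k] the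
    parts of [w] in [lp p] and in its complement; the vertices are [z], the two swapped points and
    [y]. The estimates are then averaged with the weights [t p]. *)
Lemma local_estimate (A : forall i, smooth_structure R (M i) (n i))
    (c : X -> R) (lp lm : {set {set 'I_m}} -> {set 'I_m})
    (t : {set {set 'I_m}} -> R) (S : set X)
    (phi : forall i, chart R (M i) (n i)) (x : X) (e : R) :
  Ck_manifold (prod_atlas A) 2 c -> labelling lp lm ->
  (forall p, p \in bipartitions m -> 0 <= t p <= 1) ->
  \sum_(p in bipartitions m) t p = 1 ->
  (forall p y z, S y -> S z -> c y + c z <= c (mix p y z) + c (mix p z y)) ->
  in_atlases A phi -> cdom (prod_chart phi) x -> 0 < e ->
  exists2 r, 0 < r & forall y z, S y -> S z ->
    cdom (prod_chart phi) y -> cdom (prod_chart phi) z ->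
    `|cmap (prod_chart phi) y - cmap (prod_chart phi) x| < r ->
    `|cmap (prod_chart phi) z - cmap (prod_chart phi) x| < r ->
    forall w, w = cmap (prod_chart phi) y - cmap (prod_chart phi) z ->
    (w *m g_mx c lp lm t phi x *m w^T) 0 0 <= e * `|w| ^+ 2.
Proof.
move=> hc hl ht ht1 Smon Aphi Dx e0.
pose f := c \o cinv (prod_chart phi).
have cphi : is_chart (prod_chart phi).
  by apply: prod_chart_is_chart => i; exact: atlas_chart (Aphi i).
have [oD oimg phiK _ _] := cphi.
have C2 : Ck 2 (cimg (prod_chart phi)) f by apply: hc; exists phi.
have Ux : cimg (prod_chart phi) (cmap (prod_chart phi) x) by exists x.
have fK y : cdom (prod_chart phi) y -> f (cmap (prod_chart phi) y) = c y.
  by move=> Dy; rewrite /f /comp phiK ?inE.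
(* Half of [e] compensates for the factor 2 in [gp_mx_quad]. *)
have [r r0 rP] := hessian_estimate oimg C2 Ux (divr_gt0 e0 (ltr0n R 2)).
exists r; first exact: r0.
move=> y z Sy Sz Dy Dz yr zr w wE.
rewrite /g_mx mulmx_sumr mulmx_suml summxE.
rewrite -[leRHS]mul1r -ht1 mulr_suml; apply: ler_sum => p pb.
rewrite -scalemxAr -scalemxAl mxE; apply: ler_wpM2l.
  by case/andP: (ht p pb).
rewrite gp_mx_quad (bipartition_complement pb (hl p pb)).
have w2 : `|w| <= 2 * r.
  have := ler_normB (cmap (prod_chart phi) y -
    cmap (prod_chart phi) x) (cmap (prod_chart phi) z - cmap (prod_chart phi) x).
  rewrite opprB addrA subrK -wE.
  by move: yr zr; lra.
have := rP (cmap (prod_chart phi) z) (block_restr (lp p) w)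
  (block_restr (~: lp p)%SET w) `|w| zr w2
  (block_restr_norm _ _) (block_restr_norm _ _).
have mixC : mix (lp p) z y = mix (~: lp p)%SET y z.
  apply/functional_extensionality_dep => i; rewrite /mix finset.inE.
  by case: (i \in lp p).
rewrite -addrA block_restrDC wE addrC subrK -!cmap_mix -mixC !fK//;
  try exact: mix_in_prod_chart.
by move=> /(_ (Smon _ _ _ Sy Sz)); rewrite -/f; lra.
Qed.

End LocalEstimate.

(** * Spectral theorem for real symmetric matrices *)

Section Spectral.
Context {R : rcfType}.

Lemma mulmx_tr_sum n (v : 'rV[R]_n) : (v *m v^T) 0 0 = \sum_i v 0 i ^+ 2.
Proof. by rewrite mxE; apply: eq_bigr => i _; rewrite mxE. Qed.

Lemma rV_norm2_gt0 n (v : 'rV[R]_n) : v != 0 -> 0 < (v *m v^T) 0 0.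
Proof.
move=> v0; rewrite lt0r mulmx_tr_sum sumr_ge0 ?andbT => [|i _]; last exact: sqr_ge0.
apply: contra v0 => /eqP; move/psumr_eq0P => h; apply/eqP/rowP => i.
by apply/eqP; rewrite mxE -sqrf_eq0 h// => j _; exact: sqr_ge0.
Qed.

(** For [v] different from the first basis vector [e], [H] is the reflection in the hyperplane
    orthogonal to [v - e], which exchanges the unit vectors [v] and [e]. *)
Lemma householder n (v : 'rV[R]_n.+1) : v *m v^T = 1%:M ->
  exists H : 'M[R]_n.+1,
    [/\ H^T = H, H *m H = 1%:M & delta_mx 0 0 *m H = v].
Proof.
move=> vv; pose e : 'rV[R]_n.+1 := delta_mx 0 0.
have ee : e *m e^T = 1%:M.
  by apply/matrixP => i j; rewrite !ord1 trmx_delta mul_delta_mx !mxE !eqxx.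
have [->|ve] := eqVneq v e.
  by exists 1%:M; rewrite trmx1 !mulmx1.
pose u := v - e.
pose a := (u *m u^T) 0 0.
have a0 : a != 0 by rewrite gt_eqF// rV_norm2_gt0// subr_eq0.
have uu : u *m u^T = a%:M by rewrite [LHS]mx11_scalar.
have evC : v *m e^T = e *m v^T.
  by rewrite [LHS]mx11_scalar [RHS]mx11_scalar -[RHS]tr_scalar_mx -!mx11_scalar
     trmx_mul trmxK.
pose b := (e *m v^T) 0 0.
have ev : e *m v^T = b%:M by rewrite [LHS]mx11_scalar.
have eu : e *m u^T = (b - 1)%:M.
  by rewrite linearB /= mulmxBr ev ee -raddfB.
have aE : a = 2 * (1 - b).
  rewrite /a /u linearB /= mulmxBr !mulmxBl vv ee evC ev !mxE eqxx !mulr1n; ring.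
pose c := 2 / a.
pose H : 'M[R]_n.+1 := 1%:M - c *: (u^T *m u).
have uuu : u^T *m u *m (u^T *m u) = a *: (u^T *m u).
  by rewrite mulmxA -(mulmxA u^T) uu -scalemx1 -scalemxAr mulmx1 -scalemxAl.
exists H; split.
- by rewrite /H linearB /= trmx1 linearZ /= trmx_mul trmxK.
- have c2 : c * c * a = c + c by rewrite /c; field.
  rewrite /H mulmxBr mulmx1 mulmxBl mul1mx -scalemxAr -scalemxAl uuu !scalerA.
  by rewrite c2 scalerDl opprB addrK subrK.
- rewrite -/e /H mulmxBr mulmx1 -scalemxAr mulmxA eu mul_scalar_mx scalerA.
  rewrite (_ : c * (b - 1) = -1); last by rewrite /c aE; field; move: a0;
    rewrite aE mulf_eq0 negb_or => /andP[].
  by rewrite scaleN1r opprK /u addrC subrK.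
Qed.

Lemma char_poly_conj n (H G : 'M[R]_n) : H *m H = 1%:M ->
  char_poly (H *m G *m H) = char_poly G.
Proof.
move=> HH; have HpHp : map_mx polyC H *m map_mx polyC H = 1%:M.
  by rewrite -map_mxM HH map_mx1.
rewrite /char_poly (_ : char_poly_mx _ =
  map_mx polyC H *m char_poly_mx G *m map_mx polyC H).
  by rewrite !det_mulmx mulrAC -det_mulmx HpHp det1 mul1r.
rewrite /char_poly_mx mulmxBr mulmxBl scalar_mxC -(mulmxA 'X%:M) HpHp mulmx1.
by rewrite !map_mxM.
Qed.

Lemma char_poly_block n (l : R) (G : 'M[R]_n) :
  char_poly (block_mx (l%:M : 'M[R]_1) 0 0 G) = ('X - l%:P) * char_poly G.
Proof.
rewrite /char_poly /char_poly_mx scalar_mx_block map_block_mx !map_mx0.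
rewrite opp_block_mx add_block_mx !subr0 det_ublock; congr (_ * _).
by rewrite map_scalar_mx /= -raddfB /= det_scalar1.
Qed.

(** Induction on [n]: the head of [s] is an eigenvalue, and a Householder reflection moves a unit
    eigenvector to the first basis vector. By symmetry the conjugated matrix is block diagonal, and
    the remaining block has characteristic polynomial given by the tail of [s]. The diagonal thus
    follows the order of [s]. *)
Theorem symmetric_spectral n (G : 'M[R]_n) (s : seq R) :
  G^T = G -> char_poly G = \prod_(l <- s) ('X - l%:P) ->
  size s = n /\ exists P : 'M[R]_n,
    P *m P^T = 1%:M /\ P *m G *m P^T = diag_mx (\row_i s`_i).
Proof.
elim: n G s => [|n IH] G s Gs Gc.
  have szs : size s = 0%N.
    by have := size_char_poly G; rewrite Gc size_prod_XsubC => -[].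
  split=> //; exists 1%:M; split; first by rewrite [LHS]thinmx0 [RHS]thinmx0.
  by rewrite [LHS]thinmx0 [RHS]thinmx0.
have szs : size s = n.+1.
  by have := size_char_poly G; rewrite Gc size_prod_XsubC => -[].
case: s szs Gc => // l s [szs] Gc.
have : eigenvalue G l by rewrite eigenvalue_root_char Gc big_cons rootM root_XsubC eqxx.
move=> /eigenvalueP[w wG w0].
have a0 := rV_norm2_gt0 w0; set a := (w *m w^T) 0 0 in a0.
pose v := (Num.sqrt a)^-1 *: w.
have vG : v *m G = l *: v by rewrite -scalemxAl wG !scalerA mulrC.
have vv : v *m v^T = 1%:M.
  rewrite [LHS]mx11_scalar linearZ /= -scalemxAr -scalemxAl scalerA mxE -/a.
  by rewrite -expr2 exprVn sqr_sqrtr ?ltW// mulVf// gt_eqF.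
have [H [Ht HH eH]] := householder vv.
have vH : v *m H = delta_mx 0 0 by rewrite -eH -mulmxA HH mulmx1.
pose B : 'M[R]_(1 + n) := H *m G *m H.
have Bt : B^T = B by rewrite !trmx_mul Ht Gs mulmxA.
have eB : (delta_mx 0 0 : 'rV[R]_(1 + n)) *m B = l *: delta_mx 0 0.
  by rewrite /B !mulmxA eH vG -scalemxAl vH.
have B0 j : B 0 j = l * (j == 0)%:R.
  have := congr1 (fun A : 'rV[R]_(1 + n) => A 0 j) eB.
  by rewrite -rowE !mxE eqxx /=.
pose G' := drsubmx B.
have G't : G'^T = G' by rewrite /G' trmx_drsub Bt.
have BE : B = block_mx (l%:M : 'M[R]_1) 0 0 G'.
  have l0 : lshift n (0 : 'I_1) = 0 :> 'I_(1 + n) by exact: val_inj.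
  have ur0 : ursubmx B = 0.
    by apply/matrixP => i j; rewrite !ord1 mxE mxE l0 B0 mulr0 mxE.
  rewrite -[LHS]submxK ur0; congr block_mx.
  - by apply/matrixP => i j; rewrite !ord1 mxE mxE l0 B0 eqxx !mxE mulr1.
  - by rewrite -[LHS]trmxK trmx_dlsub Bt ur0 trmx0.
have G'c : char_poly G' = \prod_(k <- s) ('X - k%:P).
  (* Cancelling the factor of [l] leaves exactly the roots in the tail. *)
  apply: (mulfI (negbT (polyXsubC_eq0 l))).
  by rewrite -char_poly_block -BE /B char_poly_conj// Gc big_cons.
have [_ [P' [P'P' P'G]]] := IH _ _ G't G'c.
split; first by rewrite /= szs.
pose D : 'M[R]_(1 + n) := block_mx 1%:M 0 0 P'.
have Dt : D^T = block_mx 1%:M 0 0 P'^T by rewrite tr_block_mx trmx1 !trmx0.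
have DD : D *m D^T = 1%:M.
  rewrite Dt /D mulmx_block !mulmx0 !mul0mx !mulmx1 !addr0 !add0r P'P'.
  by rewrite -scalar_mx_block.
have DBD : D *m B *m D^T = diag_mx (\row_i (l :: s)`_i).
  rewrite BE Dt /D !mulmx_block !mulmx0 !mul0mx !mulmx1 !mul1mx !addr0 !add0r.
  rewrite !mul0mx ?mulmx0 P'G.
  rewrite (_ : l%:M = diag_mx (l%:M : 'M[R]_1)); last first.
    by apply/matrixP => i j; rewrite !ord1 !mxE eqxx.
  rewrite -diag_mx_row; congr diag_mx; apply/rowP => i; rewrite !mxE.
  by case: split_ordP => j ->; rewrite !mxE ?ord1 ?eqxx.
exists (D *m H); rewrite trmx_mul Ht; split.
  by rewrite mulmxA -(mulmxA D) HH mulmx1; exact: DD.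
by apply: etrans DBD; rewrite /B !mulmxA.
Qed.

End Spectral.

(** * Lipschitz graphs *)

(** McShane's formula in each component: the infimum of the upper cones [z.2 0 j + K * |u - z.1|].
    Since the norm of a row is the maximum of its entries, the constant [K] is kept. *)
Lemma lipschitz_extension {R : realType} (U : normedModType R) (k : nat)
    (Z : set (U * 'rV[R]_k)) (K : R) : Z !=set0 -> 0 <= K ->
  (forall z z', Z z -> Z z' -> `|z.2 - z'.2| <= K * `|z.1 - z'.1|) ->
  exists f : U -> 'rV[R]_k,
    (forall z, Z z -> f z.1 = z.2) /\
    forall u v, `|f u - f v| <= K * `|u - v|.
Proof.
move=> Z0 K0 ZK.
pose A u j := [set z.2 0 j + K * `|u - z.1| | z in Z].
pose f u : 'rV[R]_k := \row_j inf (A u j).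
have A0 u j : A u j !=set0 by case: Z0 => z Zz; exists (z.2 0 j + K * `|u - z.1|), z.
(* The Lipschitz bound on [Z] puts every lower cone below all upper cones. Hence the infima are
   finite, and at [z.1] the infimum is the prescribed value. *)
have Alb u j z : Z z -> lbound (A u j) (z.2 0 j - K * `|u - z.1|).
  move=> Zz _ [z' Zz' <-]; rewrite lerBlDr -addrA -mulrDr -lerBlDl.
  have := mx_entry_le_norm (z.2 - z'.2) 0 j; rewrite mxB_entry.
  move=> /(le_trans (ler_norm _))/le_trans; apply.
  apply: (le_trans (ZK _ _ Zz Zz')); apply: ler_wpM2l => //.
  by have := ler_distD u z.1 z'.1; rewrite [`|z.1 - u|]distrC; lra.
have hlb u j : has_lbound (A u j).
  by case: Z0 => z Zz; exists (z.2 0 j - K * `|u - z.1|); exact: Alb.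
have half u v j : inf (A u j) <= inf (A v j) + K * `|u - v|.
  rewrite -lerBlDr; apply: lb_le_inf => // _ [z Zz <-].
  rewrite lerBlDr; apply: (@le_trans _ _ (z.2 0 j + K * `|u - z.1|)).
    by apply: (ge_inf (hlb _ j)); exists z.
  rewrite -addrA -mulrDr lerD2l ler_wpM2l//.
  by have := ler_distD v u z.1; lra.
exists f; split=> [z Zz|u v].
  apply/rowP => j; rewrite mxE; apply/eqP; rewrite eq_le; apply/andP; split.
    by apply: (ge_inf (hlb _ j)); exists z => //; rewrite subrr normr0 mulr0 addr0.
  apply: lb_le_inf => //; have := Alb z.1 j z Zz.
  by rewrite subrr normr0 mulr0 subr0.
apply: mx_norm_le => [|i j]; first by rewrite mulr_ge0.
rewrite [i]ord1 mxB_entry !mxE ler_norml lerBlDl half andbT.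
by rewrite lerNl opprB lerBlDl distrC half.
Qed.

Lemma card_enumeration (N k : nat) (B : {set 'I_N}) : #|B| = k ->
  exists b : 'I_k -> 'I_N,
    [/\ injective b, forall j, b j \in B & forall i, i \in B -> exists j, b j = i].
Proof.
move=> <-; exists (fun j => enum_val j); split.
- exact: enum_val_inj.
- by move=> j; exact: enum_valP.
- by move=> i iB; exists (enum_rank_in iB i); rewrite enum_rankK_in.
Qed.

Lemma count_card_ord (T : Type) (x0 : T) (a : pred T) (s : seq T) (N : nat) :
  size s = N -> count a s = #|[set i : 'I_N | a (nth x0 s i)]%SET|.
Proof.
move=> <-; rewrite -sum1_count (big_nth x0) big_mkord -sum1_card.
by apply: eq_bigl => i; rewrite finset.inE.
Qed.

Section PositivePart.
Context {R : realType} {N : nat}.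

(** In the coordinates [w *m P^T] the form is a weighted sum of squares. With [e] half of a lower
    bound for the positive eigenvalues, the error term is absorbed, and each positive coordinate is
    controlled by the nonpositive ones. *)
Lemma positive_part_bound (G P : 'M[R]_N) (l : 'I_N -> R) :
  P *m P^T = 1%:M -> P *m G *m P^T = diag_mx (\row_i l i) ->
  exists e K : R, [/\ 0 < e, 0 <= K & forall (w : 'rV[R]_N) (rho : R),
    (w *m G *m w^T) 0 0 <= e * `|w| ^+ 2 -> 0 <= rho ->
    (forall j, ~~ (0 < l j) -> `|(w *m P^T) 0 j| <= rho) ->
    forall i, 0 < l i -> `|(w *m P^T) 0 i| <= K * rho].
Proof.
move=> PP PGP; have PP' : P^T *m P = 1%:M by exact: mulmx1C.
(* A positive lower bound for all positive eigenvalues, which also makes sense when there are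
   none. *)
pose lam := (1 + \sum_(i | 0 < l i) (l i)^-1)^-1.
pose Lam := \sum_i `|l i|.
have lam0 : 0 < lam.
  by rewrite invr_gt0 ltr_pwDl// sumr_ge0// => i li; rewrite invr_ge0 ltW.
have lamP i : 0 < l i -> lam <= l i.
  move=> li; rewrite -[leRHS]invrK lef_pV2 ?posrE ?invr_gt0//; last first.
    by rewrite -invr_gt0.
  rewrite (bigD1 i)//= addrCA lerDl addr_ge0// sumr_ge0// => j /andP[lj _].
  by rewrite invr_ge0 ltW.
have LamP i : `|l i| <= Lam.
  by rewrite /Lam (bigD1 i)//= lerDl sumr_ge0.
have Lam0 : 0 <= Lam by rewrite sumr_ge0.
pose C := (lam / 2 + Lam) * N%:R / (lam / 2).
have C0 : 0 <= C by rewrite divr_ge0 ?mulr_ge0 ?addr_ge0// ?divr_ge0// ltW.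
(* The squares satisfy a bound with constant [C]; since [C <= (1 + C) ^+ 2], taking [1 + C] avoids a
   square root. *)
exists (lam / 2), (1 + C); split; [by rewrite divr_gt0|by rewrite addr_ge0|].
move=> w rho wG rho0 wrho i li.
set om := w *m P^T in wrho *.
have wE : w = om *m P by rewrite /om -mulmxA PP' mulmx1.
clearbody om.
have GE : (w *m G *m w^T) 0 0 = \sum_j l j * om 0 j ^+ 2.
  rewrite wE trmx_mul !mulmxA -(mulmxA om) -(mulmxA om) PGP.
  rewrite bilinearE; apply: eq_bigr => j _.
  rewrite (bigD1 j)//= big1 => [|k kj]; rewrite !mxE.
    by rewrite eqxx addr0 mulr1n; ring.
  by rewrite eq_sym (negbTE kj) mulr0n mulr0 mul0r.
(* The maximum norm is at most the Euclidean norm, which the orthogonal matrix [P] preserves. *)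
have wn : `|w| ^+ 2 <= \sum_j om 0 j ^+ 2.
  rewrite -mulmx_tr_sum (_ : _ *m _ = w *m w^T); last first.
    by rewrite wE trmx_mul mulmxA -(mulmxA om) PP mulmx1.
  rewrite mulmx_tr_sum; have [->|] := eqVneq w 0.
    by rewrite normr0 expr0n sumr_ge0// => j _; exact: sqr_ge0.
  rewrite -normr_eq0 => w0; have [[k j] kj] := mx_norm_neq0 w0.
  rewrite [X in X ^+ _](kj : `|w| = `|w k j|) real_normK ?num_real// [k]ord1.
  by rewrite (bigD1 j)//= lerDl sumr_ge0// => i' _; exact: sqr_ge0.
pose pos := [pred j | 0 < l j].
have LL0 : 0 <= lam / 2 + Lam by rewrite addr_ge0// divr_ge0// ltW.
have main : lam / 2 * om 0 i ^+ 2 <= (lam / 2 + Lam) * N%:R * rho ^+ 2.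
  have h : \sum_j (l j - lam / 2) * om 0 j ^+ 2 <= 0.
    under eq_bigr do rewrite mulrBl.
    rewrite sumrB -GE subr_le0 (le_trans wG)// -mulr_sumr ler_wpM2l//.
    by rewrite divr_ge0 ?ltW.
  rewrite (bigID pos)/= in h.
  have h1 : lam / 2 * om 0 i ^+ 2 <= \sum_(j | pos j) (l j - lam / 2) * om 0 j ^+ 2.
    rewrite (bigD1 i)//= (@le_trans _ _ ((l i - lam / 2) * om 0 i ^+ 2))//.
      by rewrite ler_wpM2r ?sqr_ge0//; have := lamP i li; lra.
    rewrite lerDl sumr_ge0// => j /andP[lj _].
    by rewrite mulr_ge0 ?sqr_ge0//; have := lamP j lj; move: lam0; lra.
  have h2 : - (\sum_(j | ~~ pos j) (l j - lam / 2) * om 0 j ^+ 2) <=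
      (lam / 2 + Lam) * N%:R * rho ^+ 2.
    rewrite -sumrN (@le_trans _ _ (\sum_(j < N) (lam / 2 + Lam) * rho ^+ 2))//.
      rewrite [leRHS](bigID pos)/= ler_wpDl//.
        by rewrite sumr_ge0// => j _; rewrite mulr_ge0// sqr_ge0.
      apply: ler_sum => j lj; rewrite -mulNr opprB.
      apply: (@le_trans _ _ ((lam / 2 + Lam) * om 0 j ^+ 2)).
        rewrite ler_wpM2r ?sqr_ge0// lerD2l (le_trans _ (LamP j))//.
        by rewrite -normrN ler_norm.
      rewrite ler_wpM2l//.
      by rewrite -real_normK ?num_real// lerXn2r ?nnegrE// wrho.
    by rewrite sumr_const card_ord -mulr_natl; lra.
  by move: h h1 h2; lra.
have sq : om 0 i ^+ 2 <= C * rho ^+ 2.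
  rewrite /C mulrAC ler_pdivlMr ?divr_gt0//.
  by move: main; lra.
have : `|om 0 i| ^+ 2 <= ((1 + C) * rho) ^+ 2.
  rewrite real_normK ?num_real// (le_trans sq)// exprMn ler_wpM2r ?sqr_ge0//.
  by move: C0; nra.
by rewrite ler_pXn2r ?nnegrE ?mulr_ge0 ?addr_ge0.
Qed.

End PositivePart.

(** * From the quadratic inequality to a Lipschitz graph *)

Section LipschitzPart.
Context {R : realType} {m : nat} {n : 'I_m -> nat}.
Context {M : 'I_m -> ptopologicalType}.
Local Notation N := (\sum_i n i)%N.
Local Notation X := (prod_topology M).

Lemma gp_mx_sym (c : X -> R) (phi : forall i, chart R (M i) (n i)) (x : X)
    (p q : {set 'I_m}) : (gp_mx c phi x p q)^T = gp_mx c phi x p q.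
Proof.
rewrite /gp_mx linear_sum; apply: eq_bigr => j _.
rewrite linear_sum; apply: eq_bigr => k _.
rewrite linear_sum; apply: eq_bigr => a _.
rewrite linear_sum; apply: eq_bigr => b _.
by rewrite linearZ linearD /= !trmx_delta addrC.
Qed.

Lemma g_mx_sym (c : X -> R) (lp lm : {set {set 'I_m}} -> {set 'I_m})
    (t : {set {set 'I_m}} -> R) (phi : forall i, chart R (M i) (n i)) (x : X) :
  (g_mx c lp lm t phi x)^T = g_mx c lp lm t phi x.
Proof.
rewrite /g_mx linear_sum; apply: eq_bigr => p _.
by rewrite linearZ /= gp_mx_sym.
Qed.

(** By [positive_part_bound], on [F] near [x] the coordinates in positive eigendirections are a
    Lipschitz function of the others. After extension, the graph over a small ball is the required
    submanifold. *)
Lemma quadratic_cone_lipschitz (A : forall i, smooth_structure R (M i) (n i))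
    (phi : forall i, chart R (M i) (n i)) (F : set X) (x : X)
    (G : 'M[R]_N) (qp qm : nat) :
  in_atlases A phi -> cdom (prod_chart phi) x -> closed F ->
  G^T = G -> signature G qp qm ->
  (forall e, 0 < e -> exists2 r, 0 < r & forall y z, F y -> F z ->
    cdom (prod_chart phi) y -> cdom (prod_chart phi) z ->
    `|cmap (prod_chart phi) y - cmap (prod_chart phi) x| < r ->
    `|cmap (prod_chart phi) z - cmap (prod_chart phi) x| < r ->
    forall w, w = cmap (prod_chart phi) y - cmap (prod_chart phi) z ->
    (w *m G *m w^T) 0 0 <= e * `|w| ^+ 2) ->
  exists O : set X, nbhs x O /\ exists S : set X,
    lipschitz_submanifold (prod_atlas A) (N - qp)%N S /\ F `&` O `<=` S.
Proof.
move=> Aphi Dx cF Gt [s [Gs sqp _]] cone.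
(* Away from the closed set [F] the empty submanifold suffices; otherwise [x] itself makes the set
   to be extended from nonempty. *)
have [Fx|nFx] := pselect (F x); last first.
  exists (~` F); split; first by apply: open_nbhs_nbhs; split => //;
    exact: closed_openC.
  by exists set0; split=> // y [].
have [szs [P [PP PGP]]] := symmetric_spectral Gt Gs.
have PP' : P^T *m P = 1%:M by exact: mulmx1C.
have [e [K [e0 K0 bound]]] := positive_part_bound PP PGP.
have [r1 r10 coner] := cone e e0.
pose pos : {set 'I_N} := [set i : 'I_N | 0 < s`_i]%SET.
have cpos : #|pos| = qp by rewrite -sqp (count_card_ord 0 _ szs).
have qpN : (qp <= N)%N by rewrite -cpos -[X in (_ <= X)%N]card_ord max_card.
have cneg : #|(~: pos)%SET| = (N - qp)%N.
  by rewrite cardsCs finset.setCK cpos card_ord.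
(* [a] lists the nonpositive eigendirections, the graph variables, and [b] the [qp] positive ones;
   the type of [b] writes their number as [N - (N - qp)]. *)
have [a [ainj ain aonto]] := card_enumeration cneg.
have [b [binj bin bonto]] : exists b : 'I_(N - (N - qp)) -> 'I_N,
    [/\ injective b, forall j, b j \in pos & forall i, i \in pos -> exists j, b j = i].
  by apply: card_enumeration; rewrite subKn.
pose psi := linear_chart (prod_chart phi) P P^T.
have cphi : is_chart (prod_chart phi).
  by apply: prod_chart_is_chart => i; exact: atlas_chart (Aphi i).
have cpsi : is_chart psi by exact: linear_chart_is_chart.
have [_ oimg psiK _ _] := cpsi.
pose om0 := cmap psi x.
have im0 : cimg psi om0 by exists x.
have : nbhs om0 (cimg psi) by exact: open_nbhs_nbhs.
move=> /nbhs_ballP[R0 /= R00 BR0].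
(* Over the ball of radius [r], the graph values are within [K * r < R0] of those at [x], so the
   whole graph lies in the image of the chart. *)
pose r := R0 / (K + 1).
have K1 : 0 < K + 1 by rewrite ltr_wpDl.
have r0 : 0 < r by rewrite divr_gt0.
have rR0 : (K + 1) * r = R0 by rewrite /r mulrC divfK// gt_eqF.
pose W := ball (colsub a om0) r.
pose O := (cdom (prod_chart phi) `&`
    cmap (prod_chart phi) @^-1` (ball (cmap (prod_chart phi) x) r1)) `&`
  (cdom psi `&` cmap psi @^-1` (ball om0 r)).
have xO : nbhs x O.
  apply: filterI; apply: chart_preimage_nbhs => //; exact: nbhsx_ballx.
have colsub_norm k (g : 'I_k -> 'I_N) (w : 'rV[R]_N) : `|colsub g w| <= `|w|.
  by apply: mx_norm_le => // i j; rewrite mxE; exact: mx_entry_le_norm.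
have norm_lt (w : 'rV[R]_N) rho : 0 < rho -> `|colsub a w| < rho ->
    `|colsub b w| < rho -> `|w| < rho.
  move=> rho0 wa wb; apply: (@le_lt_trans _ _ (Num.max `|colsub a w| `|colsub b w|)).
    apply: mx_norm_le => [|i j]; first by rewrite le_max normr_ge0.
    rewrite le_max [i]ord1; have [jp|jp] := boolP (j \in pos).
      have [k <-] := bonto j jp; apply/orP; right.
      by have := mx_entry_le_norm (colsub b w) 0 k; rewrite mxE.
    have [|k <-] := aonto j; first by rewrite finset.inE.
    apply/orP; left.
    by have := mx_entry_le_norm (colsub a w) 0 k; rewrite mxE.
  by rewrite gt_max wa wb.
pose Z := [set (colsub a (cmap psi y), colsub b (cmap psi y)) | y in F `&` O].
have Z0 : Z !=set0.
  by exists (colsub a om0, colsub b om0), x => //; split => //; exact: nbhs_singleton.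
have ZK z z' : Z z -> Z z' -> `|z.2 - z'.2| <= K * `|z.1 - z'.1|.
  move=> [y [Fy [[Dy By] _]] <-] [y' [Fy' [[Dy' By'] _]] <-] /=.
  pose w := cmap (prod_chart phi) y - cmap (prod_chart phi) y'.
  have wG : (w *m G *m w^T) 0 0 <= e * `|w| ^+ 2.
    apply: (coner y y') => //.
      by move: By; rewrite /= -ball_normE /= distrC.
    by move: By'; rewrite /= -ball_normE /= distrC.
  rewrite -!linearB /= -!mulmxBl -/w.
  apply: mx_norm_le => [|i j]; first by rewrite mulr_ge0.
  rewrite [i]ord1 mxE; apply: (bound w _ wG) => //.
    move=> k kn; have [|k' <-] := aonto k; first by rewrite !finset.inE.
    by have := mx_entry_le_norm (colsub a (w *m P^T)) 0 k'; rewrite mxE.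
  by have := bin j; rewrite finset.inE.
have [f [fZ fK]] := lipschitz_extension Z0 K0 ZK.
have f0 : f (colsub a om0) = colsub b om0.
  by apply: (fZ (colsub a om0, colsub b om0)); exists x => //; split => //;
    exact: nbhs_singleton.
(* [S] is the full graph over [W], since the definition of a Lipschitz submanifold asks for equality
   with a graph, not for inclusion. *)
pose S := [set y | [/\ cdom psi y, W (colsub a (cmap psi y)) &
   colsub b (cmap psi y) = f (colsub a (cmap psi y))]].
exists O; split=> //; exists S; split; last first.
  move=> y [Fy [Dy [Dy' By]]]; split=> //.
    rewrite /W -ball_normE /= -linearB (le_lt_trans (colsub_norm _ _ _))//.
    by move: By; rewrite /= -ball_normE.
  by symmetry; apply: (fZ (colsub a (cmap psi y), colsub b (cmap psi y))); exists y.
move=> y [Dy Wy fy].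
exists psi, a, b, W, f; split.
- by split => //; exact: linear_prod_chart_smooth.
- by split=> // i j abij; have := ain i; rewrite abij finset.inE bin.
- exact: ball_open.
- exists K; split; first exact: num_real.
  move=> k /ltW Kk [u v] _ /=; apply: (le_trans (fK u v)).
  exact: ler_wpM2r.
- rewrite eqEsubset; split=> [_ [z [[Dz Wz fz] _] <-]//|w [Ww fw]].
  have [z Dz zw] : cimg psi w.
    apply: BR0; rewrite -ball_normE /= distrC; apply: norm_lt => //.
      rewrite linearB /= distrC; move: Ww; rewrite /W -ball_normE /= =>
        /lt_le_trans; apply.
      by rewrite -rR0 ler_peMl ?lerDr// ltW.
    rewrite linearB /= fw -f0; apply: (le_lt_trans (fK _ _)).
    apply: (@le_lt_trans _ _ (K * r)).
      rewrite ler_wpM2l// ltW// distrC; move: Ww; rewrite /W -ball_normE; exact.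
    by rewrite -rR0 mulrDl mul1r ltrDl.
  exists z; last exact: zw.
  by split; [split; rewrite ?zw|].
Qed.

End LipschitzPart.

(** * Tangent vectors *)

Lemma quadratic_continuous {R : realType} {N : nat} (G : 'M[R]_N) :
  continuous (fun w : 'rV[R]_N => (w *m G *m w^T) 0 0).
Proof.
have -> : (fun w : 'rV[R]_N => (w *m G *m w^T) 0 0) =
    fun w => \sum_i \sum_j w 0 i * G i j * w 0 j.
  by apply/funext => w; rewrite bilinearE.
apply: continuous_big => [|i _]; first exact: add_continuous.
apply: continuous_big => [|j _ w]; first exact: add_continuous.
exact: (cvgM (cvgM (@coord_continuous _ 1 N 0 i w) (cvg_cst (G i j)))
  (@coord_continuous _ 1 N 0 j w)).
Qed.

Lemma quadratic_scale {R : realType} {N : nat} (G : 'M[R]_N) (k : R)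
    (w : 'rV[R]_N) :
  ((k *: w) *m G *m (k *: w)^T) 0 0 = k ^+ 2 * (w *m G *m w^T) 0 0.
Proof.
by rewrite linearZ /= -scalemxAr -!scalemxAl scalerA [LHS]mxE expr2.
Qed.

(** Dividing the inequality by [h ^+ 2] turns increments into difference quotients, which tend to
    [v]; the form is continuous, and [e] is arbitrary. *)
Lemma tangent_cone_le0 {R : realType} {N : nat} (G : 'M[R]_N)
    (u : R -> 'rV[R]_N) (v : 'rV[R]_N) :
  derivable u 0 1 -> 'D_1 u 0 = v ->
  (forall e, 0 < e -> \forall h \near 0, forall w, w = u h - u 0 ->
    (w *m G *m w^T) 0 0 <= e * `|w| ^+ 2) ->
  (v *m G *m v^T) 0 0 <= 0.
Proof.
move=> du uv cone.
have quot : (fun h => h^-1 *: (u h - u 0)) @ 0^' --> v.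
  rewrite -uv; have := du; rewrite /derivable /derive => /cvg_ex[l ul].
  rewrite (cvg_lim _ ul)//; apply: cvg_trans ul.
  apply: near_eq_cvg; apply: nearW => h /=.
  by rewrite addr0 [h *: 1]mulr1.
have le_e e : 0 < e -> (v *m G *m v^T) 0 0 - e * `|v| ^+ 2 <= 0.
  move=> e0; pose q (w : 'rV[R]_N) := (w *m G *m w^T) 0 0 - e * `|w| ^+ 2.
  have qc : continuous q.
    move=> w; have nc := @norm_continuous _ _ w.
    exact: (cvgB (@quadratic_continuous _ _ G w)
      (cvgM (cvg_cst e) (cvgM nc nc))).
  have qv : q (h^-1 *: (u h - u 0)) @[h --> 0^'] --> q v.
    exact: (@cvg_comp _ _ _ _ q _ _ _ quot (qc v)).
  apply: (closed_cvg (fun y : R => y <= 0) (@closed_le _ 0) _ _ qv).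
  have := cone e e0; move=> /nbhs_dnbhs; apply: filterS => h /(_ _ erefl) hle.
  rewrite /q quadratic_scale normrZ exprMn real_normK ?num_real//.
  by rewrite mulrCA -mulrBr mulr_ge0_le0 ?sqr_ge0// subr_le0.
rewrite leNgt; apply/negP; set Q := (v *m G *m v^T) 0 0 in le_e * => Q0.
have d0 : 0 < 2 * (1 + `|v| ^+ 2).
  by rewrite mulr_gt0// ltr_pwDl// sqr_ge0.
(* For this [e] the term [e * |v| ^+ 2] is less than [Q / 2], which contradicts [Q <= e * |v| ^+ 2]
   when [Q > 0]. *)
have := le_e (Q / (2 * (1 + `|v| ^+ 2))) (divr_gt0 Q0 d0).
rewrite subr_le0 mulrAC ler_pdivlMr// ler_pM2l//.
by have := sqr_ge0 `|v|; lra.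
Qed.

Theorem theorem2p3 (R : realType) (m : nat) (hm : (2 <= m)%N)
    (n : 'I_m -> nat) (M : 'I_m -> ptopologicalType)
    (A : forall i, smooth_structure R (M i) (n i))
    (mu : forall i, probability (borel (M i)) R)
    (c : prod_topology M -> R)
    (hc : Ck_manifold (prod_atlas A) 2 c)
    (lp lm : {set {set 'I_m}} -> {set 'I_m})
    (hl : labelling lp lm)
    (t : {set {set 'I_m}} -> R)
    (ht : forall p, p \in bipartitions m -> 0 <= t p <= 1)
    (ht1 : \sum_(p in bipartitions m) t p = 1)
    (gamma : {measure set (borel (prod_topology M)) -> \bar R})
    (hgamma : optimizer c mu gamma)
    (hfin : cost_finite c gamma) :
  (forall (x : prod_topology M) (qp qm : nat),
     signature_at A c lp lm t x qp qm ->
     exists O : set (prod_topology M),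
       nbhs x O /\
       exists S : set (prod_topology M),
         lipschitz_submanifold (prod_atlas A) (\sum_i n i - qp)%N S /\
         spt gamma `&` O `<=` S) /\
  (forall (y : prod_topology M) (d : nat),
     spt gamma y ->
     smooth_submanifold_near (prod_atlas A) d (spt gamma) y ->
     forall (phi : forall i, chart R (M i) (n i)) (v : 'rV[R]_(\sum_i n i)),
       in_atlases A phi -> cdom (prod_chart phi) y ->
       tangent_in (spt gamma) (prod_chart phi) y v ->
       (v *m g_mx c lp lm t phi y *m v^T) 0 0 <= 0).
Proof.
have m0 : (0 < m)%N by exact: ltn_trans hm.
have cc : continuous c by exact: Ck_manifold_continuous hc.
have mon p y z : spt gamma y -> spt gamma z ->
    c y + c z <= c (mix p y z) + c (mix p z y).
  apply: spt_monotone hgamma hfin => // i.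
  exact: manifold_second_countable (A i).
split=> [x qp qm [phi [Aphi Dx sig]]|y d yspt _ phi v Aphi Dy].
  apply: (quadratic_cone_lipschitz Aphi Dx (@spt_closed _ _ gamma)
    (g_mx_sym _ _ _ _ _ _) sig) => e e0.
  exact: (local_estimate hc hl ht ht1 mon Aphi Dx e0).
move=> [e1 [tau [e10 tau0 tauS dtau tauv]]].
have [dtau1 _] := dtau 1%N.
have b0 : ball (0 : R) e1 0 by exact: ballxx.
have dtau0 : differentiable (cmap (prod_chart phi) \o tau) 0.
  by apply: dtau1; rewrite inE.
have der0 : derivable (cmap (prod_chart phi) \o tau) 0 1 by exact: diff_derivable.
apply: (tangent_cone_le0 der0 tauv) => e e0.
(* The estimate is applied to pairs formed by the fixed point [y = tau 0] and a nearby point [tau h]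
   of the curve, both in the support. *)
have [r r0 rP] := local_estimate hc hl ht ht1 mon Aphi Dy e0.
have nearr : \forall h \near 0, `|cmap (prod_chart phi) (tau h) -
  cmap (prod_chart phi) y| < r.
  have /cvgrPdist_lt/(_ r r0) := differentiable_continuous dtau0.
  by apply: filterS => h; rewrite /= tau0 distrC.
have nearb : \forall h \near (0 : R), ball (0 : R) e1 h by exact: nbhsx_ballx.
apply: filterS2 nearr nearb => h hr hb w wE.
have [hS hD] := tauS h hb.
apply: (rP (tau h) y hS yspt hD Dy hr) => //.
  by rewrite subrr normr0.
by rewrite wE /= tau0.
Qed.
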